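(* Let $(\Gamma,S)$ be a $\delta$-hyperbolic group and let $R\ge12\delta$ be an even integer, so that the augmented Rips complex $C_*^R(\Gamma,\mathbb{C})$ is contractible. Let $\eta_*:C_*(\Gamma,\mathbb{C})\to C_*^R(\Gamma,\mathbb{C})$ be a $\Gamma$-equivariant deformation retraction of the Bar complex onto the Rips complex of scale $R$. There exists a family of linear operators $$h_*^x:C_*^R(\Gamma,\mathbb{Q})\to C_{*+1}^R(\Gamma,\mathbb{Q}),\qquad x\in\Gamma,\ *\ge-1,$$ on the augmented Rips complex satisfying $$h_*^x\circ\partial+\partial\circ h_*^x=\mathrm{id}$$ and such that the following assertions hold. (1) $\pi(g)\circ h_*^x=h_*^{gx}\circ\pi(g)$ for all $g\in\Gamma$ and $x\in\Gamma$, where $\pi$ denotes the action of $\Gamma$ on $C_*^R(\Gamma,\mathbb{Q})$. (2) The matrix coefficients $\langle h_n^x(\alpha),\beta\rangle$ vanish unless $$Supp(\beta)\subset B\big(geod(Supp(\alpha)\cup\{x\}),C_6(\delta,R,\eta,n)\big)$$ and satisfy $|\langle h_n^x(\alpha),\beta\rangle|\le C_7(\delta,|S|,R,\eta,n)$ for suitable constants $C_6=C_6(\delta,R,\eta,n)$ and $C_7=C_7(\delta,|S|,R,\eta,n)$. (3) For all $x,x'\in\Gamma$, $\alpha\in\Delta_n^R(\Gamma)$, $\beta\in\Delta_{n+1}^R(\Gamma)$, $$|\langle(h_n^x-h_n^{x'})(\alpha),\beta\rangle|\le C_8\cdot\lambda_1^{(x|x')_\beta},\qquad (x|x')_\beta=\min_{z\in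 Supp(\beta)}(x|x')_z,$$ for a suitable constant $C_8=C_8(\delta,|S|,R,\eta,\lambda_1,n,d(x,x'))$.
   Context: Hyperbolic groups. For a subset $Y$ of a metric space, $B(Y,R)=\{x:\inf_{y\in Y}d(x,y)\le R\}$ and $geod(Y)=\{p:\exists y,y'\in Y,\ d(y,p)+d(p,y')=d(y,y')\}$. A geodesic metric space is $\delta$-hyperbolic if in every geodesic triangle each side lies in the closed $\delta$-neighbourhood of the union of the other two. $\Gamma$ is a group with finite symmetric generating set $S$ and word metric $d$; $(\Gamma,S)$ is a $\delta$-hyperbolic group if its Cayley graph (vertices $\Gamma$, edges of length one from $g$ to $gs$) is $\delta$-hyperbolic; $\delta$ is a strictly positive integer. Gromov product: $(x|y)_z=\frac12(d(x,z)+d(y,z)-d(x,y))$. Fix for every $g\in\Gamma$ a word of minimal length in $S$ representing it; this gives for $x,y\in\Gamma$ a distinguished geodesic $\overline{xy}$ in the Cayley graph, equivariantly under left translation. Bar and Rips complexes. $\Delta_n(\Gamma)=\Gamma^{n+1}$, $\Delta_n^R(\Gamma)=\{[x_0,\dots,x_n]\in\Gamma^{n+1}:d(x_i,x_j)\le R\}$, $Supp([x_0,\dots,x_n])=\{x_0,\dots,x_n\}$. $C_*(\Gamma,k)$ (Bar chain complex) and $C_*^R(\Gamma,k)$ (Rips chain complex) are the free modules over the coefficients $k$ on $\Delta_*(\Gamma)$ resp. $\Delta_*^R(\Gamma)$ modulo degenerate simplices (two consecutive equal entries), with the alternating sum of face maps as differential $\partial$; the augmented complexes have $k$ in degree $-1$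 and $[x_0]\mapsto1$ as augmentation. $\Gamma$ acts by left translation. The matrix coefficients of a linear map $\varphi$ are the scalars with $\varphi(\alpha)=\sum_\beta\langle\varphi(\alpha),\beta\rangle\beta$, over (nondegenerate) simplices $\beta$. A $\Gamma$-equivariant deformation retraction $\eta_*$ is a $\Gamma$-equivariant chain map (compatible with augmentations) restricting to the identity on $C_*^R(\Gamma,\mathbb{C})$ whose composition with the inclusion $C_*^R(\Gamma,\mathbb{C})\hookrightarrow C_*(\Gamma,\mathbb{C})$ is equivariantly chain homotopic to the identity. The constant $\lambda_1$. Fix maps $\varphi_k:\Gamma\times\Gamma\to C_0(\Gamma,\mathbb{Q})$, $\varphi_k(x,y)=\sum_z c_k^{x,y}(z)[z]$, $k\ge1$ (these exist by work of Mineyev), such that: $c_k^{x,y}(z)\ge0$, $\sum_zc_k^{x,y}(z)=1$; $\varphi_k(x,y)=[x]$ if $d(x,y)\le10k\delta$; $Supp\,\varphi_k(x,y)\subset\{z\in B(\overline{xy},\delta):d(z,y)=10k\delta\}$ if $d(x,y)>10k\delta$; $\varphi_k(gx,gy)=g\varphi_k(x,y)$; $\|\varphi_k(x,y)-\varphi_k(x',y)\|_1\le C_1\lambda_1^{(x|x')_y-10k\delta}$ for all $x,x',y$, with constants $C_1=C_1(\delta,|S|)>0$ and $0<\lambda_1=\lambda_1(\delta,|S|)<1$. This $\lambda_1$ is the one occurring in (3). Constants $C(a,b,\dots)$ depend only on the listed parameters and are monotone increasing in the numerical ones among them. *)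

(* Defs.v *)
(* The group is an arbitrary [groupType]; reals are an arbitrary [realType] K
   and complex numbers are [K[i]].  Free modules are [malg] (finitely supported
   functions, from multinomials); the notations of [monalg] are not imported
   because they are incompatible with those of MathComp-Analysis. *)
From HB Require Import structures.
From mathcomp Require Import all_boot all_order all_algebra.
From mathcomp Require Import finmap.
From mathcomp Require Import all_classical all_reals all_analysis.
From mathcomp Require Import complex.
From mathcomp Require Import -(notations) monalg.

Set Implicit Arguments.
Unset Strict Implicit.
Unset Printing Implicit Defensive.

Import Order.TTheory GRing.Theory Num.Theory.

Local Open Scope classical_set_scope.
Local Open Scope ring_scope.

Section MetricGeometry.
Context {K : realType} {X : Type} (dist : X -> X -> K).

(* The extended infimum of the empty set is +oo, so that B(set0, r) = set0. *)
Definition nbhd_of (Y : set X) (r : K) : set X :=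
  [set x | (ereal_inf [set (dist x y)%:E | y in Y] <= r%:E)%E].

Definition geod (Y : set X) : set X :=
  [set p | exists y y', [/\ Y y, Y y' & dist y p + dist p y' = dist y y']].

Definition gromov (x y z : X) : K :=
  2^-1 * (dist x z + dist y z - dist x y).

Definition geodesic_segment (p q : X) (A : set X) : Prop :=
  exists c : K -> X,
    [/\ c 0 = p, c (dist p q) = q,
        {in `[0, dist p q] &, forall s t, dist (c s) (c t) = `|s - t|} &
        A = c @` [set` `[0, dist p q]]].

(* The thin triangle condition only; that the space is geodesic is not part of
   the definition.  It holds for the Cayley graph of a symmetric generating
   set. *)
Definition hyperbolic (delta : K) : Prop :=
  forall (p q u : X) (A B C : set X),
    geodesic_segment p q A -> geodesic_segment q u B ->
    geodesic_segment u p C ->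
    [/\ A `<=` nbhd_of (B `|` C) delta,
        B `<=` nbhd_of (C `|` A) delta &
        C `<=` nbhd_of (A `|` B) delta].

End MetricGeometry.

Section WordMetric.
Context {G : groupType} (S : {fset G}).
Local Open Scope group_scope.

Definition symmetric_subset : Prop := forall s, s \in S -> s^-1 \in S.

Definition represents (w : seq G) (g : G) : Prop :=
  {subset w <= S} /\ \prod_(s <- w) s = g.

Definition generating : Prop := forall g, exists w, represents w g.

(* The value is 0 on elements outside of the submonoid generated by S; this
   does not occur when S is symmetric and generating. *)
Definition word_length (g : G) : nat :=
  match pselect (exists n,
          `[< exists w, size w = n /\ represents w g >]) with
  | left e => ex_minn e
  | right _ => 0%N
  end.

Definition word_dist (x y : G) : nat := word_length (x^-1 * y).

Definition geodesic_words (w : G -> seq G) : Prop :=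
  forall g, represents (w g) g /\ size (w g) = word_length g.

End WordMetric.

Definition word_metric (K : realType) (G : groupType) (S : {fset G})
  (x y : G) : K := (word_dist S x y)%:R.

(* [EdgePoint g s t] is the point at distance t from g on the edge from g to
   g * s.  A point of the Cayley graph has several such names: for s != 1,
   (g, s, t) and (g * s, s^-1, 1 - t) lie on the same edge and coincide, and
   edge points with t = 0 or t = 1 are vertices.  [cayley_dist] is thus a
   pseudometric, whose associated metric space is the Cayley graph.  If 1 is
   in S, the edge from g to g * 1 is a loop of length one. *)
Inductive cayley_point (K : realType) (G : groupType) (S : {fset G}) : Type :=
| Vertex of G
| EdgePoint of G & S & {i01 K}.

Arguments Vertex {K G S} g.
Arguments EdgePoint {K G S} g s t.

Section CayleyGraph.
Context {K : realType} {G : groupType} {S : {fset G}}.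

(* Nearby vertices, with the distance to them along the edge. *)
Definition exits (p : cayley_point K S) : seq (G * K) :=
  match p with
  | Vertex g => [:: (g, 0)]
  | EdgePoint g s t =>
      [:: (g, t%:num); ((g * \val s)%g, 1 - t%:num)]
  end.

(* Lengths of the paths from p to q inside one edge, not crossing a vertex. *)
Definition edge_paths (p q : cayley_point K S) : set K :=
  match p, q with
  | EdgePoint g s t, EdgePoint h u t' =>
      [set l | (h = g /\ u = s) /\ l = `|t%:num - t'%:num| \/
               [/\ h = (g * \val s)%g, \val u = ((\val s)^-1)%g & \val s <> 1%g]
               /\ l = `|t%:num - (1 - t'%:num)|]
  | _, _ => set0
  end.

Definition cayley_dist (p q : cayley_point K S) : K :=
  inf (edge_paths p q `|`
       [set l | exists e f, [/\ e \in exits p, f \in exits q &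
                  l = e.2 + word_metric K S e.1 f.1 + f.2]]).

(* Path in the Cayley graph starting at x and following the word w. *)
Definition word_path (x : G) (w : seq G) : set (cayley_point K S) :=
  [set Vertex x] `|`
  [set p | exists (i : nat) (s : S) (t : {i01 K}),
     [/\ (i < size w)%N, \val s = nth 1%g w i &
         p = EdgePoint (x * \prod_(a <- take i w) a)%g s t]].

Definition chosen_geodesic (w : G -> seq G) (x y : G) :
  set (cayley_point K S) := word_path x (w (x^-1 * y)%g).

End CayleyGraph.

(* Simplices are indexed by their number m of vertices: m-tuples span the
   chains of degree m - 1.  The empty tuple is the generator of the augmented
   complex in degree -1, and the boundary of a one-vertex simplex is the
   augmentation.  The quotient of the free module on all simplices by the
   degenerate ones is the free module on the nondegenerate simplices. *)
Section Chains.
Context {G : groupType}.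

Definition nondegenerate (x : seq G) : bool := sorted [rel a b | a != b] x.

Record simplex (P : pred (seq G)) (m : nat) := Simplex {
  simplex_tuple : m.-tuple G;
  _ : P simplex_tuple && nondegenerate simplex_tuple
}.

HB.instance Definition _ P m := [isSub of simplex P m for @simplex_tuple P m].

(* Opaque instances: unification would otherwise compute with the supports of
   chains, and diverge. *)
Fact simplex_eq P m : hasDecEq (simplex P m).
Proof. exact: (Equality.on (sub_type (simplex P m))). Qed.

Fact simplex_choice P m : hasChoice (simplex P m).
Proof. exact: (Choice.on (sub_type (simplex P m))). Qed.

HB.instance Definition _ P m := simplex_eq P m.
HB.instance Definition _ P m := simplex_choice P m.

Definition bar : pred (seq G) := predT.

Definition rips (S : {fset G}) (r : nat) : pred (seq G) :=
  fun x => all2rel (fun a b => (word_dist S a b <= r)%N) x.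

Definition chain (k : comNzRingType) (P : pred (seq G)) (m : nat) :=
  malg (simplex P m) k.

Context {k : comNzRingType}.

(* The class of a simplex, which is 0 if the simplex is degenerate. *)
Definition cls (P : pred (seq G)) (m : nat) (x : m.-tuple G) : chain k P m :=
  if insub x is Some a then mkmalgU a 1 else 0.

Context {P : pred (seq G)} {m : nat}.

Definition coef (c : chain k P m) (a : simplex P m) : k := mcoeff a c.

Definition lin_ext (V : lmodType k) (f : m.-tuple G -> V) (c : chain k P m) :
  V := \sum_(a <- msupp c) coef c a *: f (\val a).

Definition act (g : G) : chain k P m -> chain k P m :=
  lin_ext (fun x => cls P [tuple of [seq (g * a)%g | a <- x]]).

Definition to_bar : chain k P m -> chain k bar m :=
  lin_ext (fun x => cls bar x).

Definition vertices (a : simplex P m) : set G := [set z | z \in tval (\val a)].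

End Chains.

Definition face (G : groupType) (m : nat) (i : 'I_m.+1) (x : m.+1.-tuple G) :
  m.-tuple G := [tuple tnth x (lift i j) | j < m].

Definition boundary (G : groupType) (k : comNzRingType) (P : pred (seq G))
    (m : nat) : chain k P m.+1 -> chain k P m :=
  lin_ext (fun x => \sum_(i < m.+1) (-1) ^+ i *: cls P (face i x)).

Definition norm1 (G : groupType) (P : pred (seq G)) (m : nat)
  (c : chain rat P m) : rat := \sum_(a <- msupp c) `|coef c a|.

(* [eta n] and [H n] are the components in degree n; the second field is
   compatibility with the augmentations, and the homotopy is one of the
   unaugmented bar complex. *)
Record equivariant_deformation_retraction (G : groupType) (S : {fset G})
    (r : nat) (k : comNzRingType)
    (eta : forall n, {linear chain k (@bar G) n.+1 ->
                             chain k (rips S r) n.+1}) : Prop := {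
  edr_chain_map : forall n (c : chain k bar n.+2),
    boundary (eta n.+1 c) = eta n (boundary c);
  edr_augmentation : forall c : chain k bar 1,
    to_bar (boundary (eta 0%N c)) = boundary c;
  edr_equivariant : forall n (g : G) (c : chain k bar n.+1),
    eta n (act g c) = act g (eta n c);
  edr_retraction : forall n (c : chain k (rips S r) n.+1),
    eta n (to_bar c) = c;
  edr_homotopy :
    exists H : forall n, {linear chain k (@bar G) n.+1 ->
                                 chain k (@bar G) n.+2},
      [/\ forall n (g : G) (c : chain k bar n.+1),
            H n (act g c) = act g (H n c),
          forall c : chain k bar 1,
            to_bar (eta 0%N c) - c = boundary (H 0%N c) &
          forall n (c : chain k bar n.+2),
            to_bar (eta n.+1 c) - c
            = boundary (H n.+1 c) + H n (boundary c)]
}.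

Record mineyev_maps (K : realType) (G : groupType) (S : {fset G})
    (delta : nat) (w : G -> seq G) (C1 lambda1 : K)
    (phi : nat -> G -> G -> chain rat (@bar G) 1) : Prop := {
  mm_ge0 : forall l x y a, (0 < l)%N -> 0 <= coef (phi l x y) a;
  mm_sum : forall l x y, (0 < l)%N ->
    \sum_(a <- msupp (phi l x y)) coef (phi l x y) a = 1;
  mm_near : forall l x y, (0 < l)%N ->
    (word_dist S x y <= 10 * l * delta)%N ->
    phi l x y = cls bar [tuple x];
  mm_supp : forall l x y a z, (0 < l)%N ->
    (10 * l * delta < word_dist S x y)%N ->
    coef (phi l x y) a != 0 -> vertices a z ->
    nbhd_of cayley_dist (chosen_geodesic w x y : set (cayley_point K S))
      delta%:R (Vertex z)
    /\ word_dist S z y = (10 * l * delta)%N;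
  mm_equivariant : forall l g x y, (0 < l)%N ->
    phi l (g * x)%g (g * y)%g = act g (phi l x y);
  mm_decay : forall l x x' y, (0 < l)%N ->
    ratr (norm1 (phi l x y - phi l x' y))
    <= C1 * lambda1 `^
         (gromov (word_metric K S) x x' y - (10 * l * delta)%:R)
}.

Definition gromov_min (K : realType) (G : groupType) (S : {fset G})
    (r m : nat) (x x' : G) (b : simplex (rips S r) m.+1) : K :=
  let p z := gromov (word_metric K S) x x' z in
  \big[Num.min/p (thead (\val b))]_(z <- \val b) p z.

Definition monotone3 (K : realType) (C : nat -> nat -> nat -> K) : Prop :=
  forall a a' b b' c c', (a <= a')%N -> (b <= b')%N -> (c <= c')%N ->
    C a b c <= C a' b' c'.

Definition monotone4 (K : realType) (C : nat -> nat -> nat -> nat -> K) :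
    Prop :=
  forall a a', (a <= a')%N -> forall b b' c c' d d', (b <= b')%N ->
    (c <= c')%N -> (d <= d')%N -> C a b c d <= C a' b' c' d'.

Definition monotone6 (K : realType)
    (C : nat -> nat -> nat -> K -> nat -> nat -> K) : Prop :=
  forall a a' b b' c c' l l' e e' f f', (a <= a')%N -> (b <= b')%N ->
    (c <= c')%N -> l <= l' -> (e <= e')%N -> (f <= f')%N ->
    C a b c l e f <= C a' b' c' l' e' f'.

(* Main.v *)
Require Import Defs.
From HB Require Import structures.
From mathcomp Require Import all_boot all_order all_algebra.
From mathcomp Require Import finmap.
From mathcomp Require Import all_classical all_reals all_analysis.
From mathcomp Require Import complex.
From mathcomp Require Import -(notations) monalg.
From mathcomp Require Import zify ring lra.

Set Implicit Arguments.
Unset Strict Implicit.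
Unset Printing Implicit Defensive.

Import Order.TTheory GRing.Theory Num.Theory.

Local Open Scope classical_set_scope.
Local Open Scope ring_scope.

(** Let every vertex [y] flow towards [x] with constant speed along Mineyev's
    maps: at time [k] it has become the probability measure [flow x k y], which
    is [y] itself at time zero, lies near the geodesic from [x] to [y] at
    distance [10 * k * delta] from [y], and stays at [x] after its arrival.
    Multilinear extension to simplices gives chain maps of the bar complex, from
    the identity to a constant map, and consecutive ones are connected by prism
    operators. Composed with the retraction [eta] and summed over all times, the
    prisms contract the Rips complex, as [eta] is the identity there; the
    constant map is cancelled by the vertex [x], the value in degree minus one
    ([cone_homotopy]).

    Two points need care. The retraction has complex coefficients. The rationals
    are a direct summand of the complex numbers as a rational vector space
    ([rational_projection]), and projecting the coefficients of [eta] to this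
    summand preserves all its properties. Moreover, the multilinear extension
    does not preserve degenerate simplices: the square of a measure need not be
    degenerate. So a simplex [z0 ... zn] is first replaced by
    [z0 (z1 - z0) ... (zn - z(n-1))], which represents the same normalized
    chain, depends on it alone, and has the right boundary ([normalize_delta]).
    Products and differences of letters are to be read in the free associative
    algebra on [G], with the boundary as a derivation.

    The estimates rest on thin triangles. They show that the flows of two
    adjacent vertices stay close ([flow_diam]). Up to translation there are only
    finitely many simplices of bounded diameter, so the retraction has bounded
    coefficients and bounded displacement on the prisms ([retract_bounded]), and
    the homotopy is supported near geodesics from [x] to the vertices. A given
    simplex [b] of the Rips complex is met at boundedly many times only
    ([flow_time]), whence bounded coefficients ([coef_cone_bound]).

    For two base points [x] and [x'], the measures [flow x k y] and
    [flow x' k y] differ by at most a multiple of the power of [lambda1] with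
    exponent [(x|x')_y - 10 * k * delta]. At the time [k] when the flow meets a
    vertex [q] of [b], the distance of [q] to [x] is about
    [dist x y - 10 * k * delta]. Since [(x|x')_q] is at most [dist x q], and
    since [(x|x')_y] is at least [dist x y - dist x x'], this exponent is at
    least [(x|x')_q] up to a constant depending on [dist x x']
    ([flow_gromov]). *)

Local Notation nondeg := Defs.nondegenerate.

(** * Chains as finitely supported functions *)

Section LinearExtension.
Context {G : groupType} {k : comNzRingType} {P : pred (seq G)} {m : nat}.
Implicit Types (c : chain k P m) (a b : simplex P m) (x : m.-tuple G).

(** A coefficient as a linear form, so that [linear_sum] and the like apply. *)
Definition coef_at b c : k^o := coef c b.

Lemma coef_at_is_linear b : linear (coef_at b).
Proof. by move=> s c c'; rewrite /coef_at /coef mcoeffD mcoeffZ. Qed.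

HB.instance Definition _ b :=
  GRing.isLinear.Build k (chain k P m) k^o *:%R _ (coef_at_is_linear b).

Lemma coefP s c c' b : coef (s *: c + c') b = s * coef c b + coef c' b.
Proof. by rewrite /coef mcoeffD mcoeffZ. Qed.

Lemma coefU a b : coef (mkmalgU a (1 : k)) b = (a == b)%:R.
Proof. by rewrite /coef mcoeffU. Qed.

Lemma chain_basis c : c = \sum_(a <- msupp c) coef c a *: mkmalgU a 1.
Proof.
rewrite [LHS]monalgE; apply: eq_bigr => a _; apply/malgP => b.
by rewrite mcoeffZ !mcoeffU mulrnAr mulr1.
Qed.

Lemma chainP c c' : (forall b, coef c b = coef c' b) -> c = c'.
Proof. by move=> h; apply/malgP. Qed.

Lemma lin_ext_widen (V : lmodType k) (f : m.-tuple G -> V) c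
    (D : {fset simplex P m}) :
  {subset msupp c <= D} ->
  lin_ext f c = \sum_(a <- D) coef c a *: f (\val a).
Proof.
move=> /fsubsetP sD; rewrite /lin_ext; apply: big_fset_incl => // a _.
by rewrite -mcoeff_eq0 => /eqP; rewrite /coef => ->; rewrite scale0r.
Qed.

Lemma lin_ext_is_linear (V : lmodType k) (f : m.-tuple G -> V) :
  linear (lin_ext f : chain k P m -> V).
Proof.
move=> s c c'; pose D := (msupp c `|` msupp c')%fset.
rewrite (@lin_ext_widen _ _ c D); last by move=> a; rewrite inE => ->.
rewrite (@lin_ext_widen _ _ c' D); last by move=> a; rewrite inE orbC => ->.
rewrite (@lin_ext_widen _ _ (s *: c + c') D); last first.
  move=> a /(fsubsetP (msuppD_le _ _)); rewrite !inE => /orP[|->]; last first.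
    by rewrite orbT.
  by move=> /(fsubsetP (msuppZ_le _ _)) ->.
rewrite scaler_sumr -big_split; apply: eq_bigr => a _ /=.
by rewrite coefP scalerDl scalerA.
Qed.

HB.instance Definition _ (V : lmodType k) (f : m.-tuple G -> V) :=
  GRing.isLinear.Build k (chain k P m) V *:%R _ (lin_ext_is_linear f).

Lemma lin_extU (V : lmodType k) (f : m.-tuple G -> V) a :
  lin_ext f (mkmalgU a (1 : k)) = f (\val a).
Proof.
rewrite (@lin_ext_widen _ _ _ [fset a]%fset).
  by rewrite big_seq_fset1 coefU eqxx scale1r.
by move=> b; apply/fsubsetP/msuppU_le.
Qed.

Lemma eq_lin_ext (V : lmodType k) (f f' : m.-tuple G -> V) c :
  (forall a, a \in msupp c -> f (\val a) = f' (\val a)) ->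
  lin_ext f c = lin_ext f' c.
Proof. by move=> h; apply: eq_big_seq => a /h ->. Qed.

Lemma lin_ext_comp (V W : lmodType k) (L : {linear V -> W})
    (f : m.-tuple G -> V) c :
  L (lin_ext f c) = lin_ext (fun x => L (f x)) c.
Proof.
by rewrite /lin_ext linear_sum; apply: eq_bigr => a _; rewrite linearZZ.
Qed.

Lemma simplexP a : P (\val a) /\ nondeg (\val a).
Proof. by case: a => x /= /andP[]. Qed.

Lemma clsU a : cls P (\val a) = mkmalgU a (1 : k).
Proof. by rewrite /cls valK. Qed.

Lemma cls_out x : ~~ (P x && nondeg x) -> cls P x = 0 :> chain k P m.
Proof. by move=> h; rewrite /cls insubN. Qed.

Lemma cls_degenerate x : ~~ nondeg x -> cls P x = 0 :> chain k P m.
Proof. by move=> h; rewrite cls_out // negb_and h orbT. Qed.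

Lemma cls_in x : P x -> nondeg x ->
  exists2 a : simplex P m, \val a = x & cls P x = mkmalgU a (1 : k).
Proof.
move=> Px nx; have h : P x && nondeg x by rewrite Px.
by exists (Sub x h); rewrite ?SubK // -clsU SubK.
Qed.

(** A function on tuples induces a map on chains with the expected value on the
    class of a degenerate tuple only if it vanishes there. *)
Lemma lin_ext_cls (V : lmodType k) (f : m.-tuple G -> V) x :
  P x -> (~~ nondeg x -> f x = 0) -> lin_ext f (cls P x) = f x.
Proof.
move=> Px; case: (boolP (nondeg x)) => nx h.
  by have [a <- ->] := cls_in Px nx; rewrite lin_extU.
by rewrite cls_degenerate // linear0 h.
Qed.

Lemma linear_ext_eq (V : lmodType k) (f g : {linear chain k P m -> V}) :
  (forall a, f (mkmalgU a 1) = g (mkmalgU a 1)) -> f =1 g.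
Proof.
move=> h c; rewrite (chain_basis c) !linear_sum.
by apply: eq_bigr => a _; rewrite !linearZZ h.
Qed.

End LinearExtension.

HB.instance Definition _ (G : groupType) (k : comNzRingType)
    (P : pred (seq G)) (m : nat) :=
  GRing.Linear.copy (@boundary G k P m) (@boundary G k P m).

(** * Integration against finitely supported measures on the group *)

Section Integration.
Context {G : groupType}.
Notation measure := (chain rat (@bar G) 1).

Definition mass (q : measure) : rat := \sum_(a <- msupp q) coef q a.

Definition charged (q : measure) (z : G) : Prop :=
  exists2 a, coef q a != 0 & thead (\val a) = z.

Definition is_prob (q : measure) : Prop :=
  (forall a, 0 <= coef q a) /\ mass q = 1.

Definition integ (V : lmodType rat) (q : measure) (f : G -> V) : V :=
  lin_ext (fun t => f (thead t)) q.

Context {V W : lmodType rat}.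
Implicit Types (q : measure) (f g : G -> V).

Lemma integ_comp (L : {linear V -> W}) q f :
  L (integ q f) = integ q (fun z => L (f z)).
Proof. exact: lin_ext_comp. Qed.

Lemma eq_integ q f g :
  (forall z, charged q z -> f z = g z) -> integ q f = integ q g.
Proof.
move=> h; apply: eq_lin_ext => a; rewrite -mcoeff_neq0 => ha.
by apply: h; exists a.
Qed.

Lemma integD q f g : integ q (fun z => f z + g z) = integ q f + integ q g.
Proof.
by rewrite /integ /lin_ext -big_split; apply: eq_bigr => a _; rewrite scalerDr.
Qed.

Lemma integN q f : integ q (fun z => - f z) = - integ q f.
Proof.
by rewrite /integ /lin_ext -sumrN; apply: eq_bigr => a _; rewrite scalerN.
Qed.

Lemma integB q f g : integ q (fun z => f z - g z) = integ q f - integ q g.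
Proof. by rewrite integD integN. Qed.

Lemma integ0 q : integ q (fun=> 0 : V) = 0.
Proof. by rewrite /integ /lin_ext big1 // => a _; rewrite scaler0. Qed.

Lemma integ_cst q (v : V) : mass q = 1 -> integ q (fun=> v) = v.
Proof. by rewrite /integ /lin_ext -scaler_suml /mass => ->; rewrite scale1r. Qed.

Lemma integ_dirac y f : integ (cls bar [tuple y]) f = f y.
Proof. by rewrite /integ lin_ext_cls. Qed.

Lemma integBl q q' f : integ (q - q') f = integ q f - integ q' f.
Proof. exact: linearB. Qed.

Lemma act_lin_ext (k : comNzRingType) (P : pred (seq G)) m (U : lmodType k)
    (g : G) (f : m.-tuple G -> U) (c : chain k P m) :
  (forall x : m.-tuple G, P x -> P [seq (g * a)%g | a <- x]) ->
  lin_ext f (act g c) = lin_ext (fun x => f [tuple of [seq (g * a)%g | a <- x]]) c.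
Proof.
move=> hP; rewrite /act lin_ext_comp; apply: eq_lin_ext => a _.
have [Pa na] := simplexP a.
apply: lin_ext_cls; first exact: hP.
move/negP; case; move: na => /=; rewrite /nondeg sorted_map.
by apply: sub_sorted => x y /= ; apply: contra => /eqP/mulgI ->.
Qed.

Lemma integ_act (x : G) q f : integ (act x q) f = integ q (fun z => f (x * z)%g).
Proof.
rewrite /integ act_lin_ext //; apply: eq_lin_ext => a _; congr f.
by case/tupleP: (\val a) => y t; rewrite !theadE.
Qed.

Lemma charged_dirac y z : charged (cls bar [tuple y]) z -> z = y.
Proof.
have [//|//|a aE ->] := @cls_in G rat bar 1 [tuple y].
case=> b; rewrite coefU; have [<- _ <-|_] := eqVneq a b; last by rewrite eqxx.
by rewrite aE theadE.
Qed.

Lemma is_prob_dirac y : is_prob (cls bar [tuple y]).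
Proof.
have [//|//|a aE ->] := @cls_in G rat bar 1 [tuple y].
split=> [b|]; first by rewrite coefU ler0n.
by rewrite /mass msuppU oner_eq0 big_seq_fset1 coefU eqxx.
Qed.

End Integration.

Section IntegralBounds.
Context {G : groupType}.
Notation measure := (chain rat (@bar G) 1).
Implicit Types (q : measure) (f : G -> rat^o) (B : rat).

Lemma integ_norm1 q f B : (forall z, charged q z -> `|f z| <= B) ->
  `|integ q f| <= norm1 q * B.
Proof.
move=> h; rewrite /integ /lin_ext; apply: le_trans (ler_norm_sum _ _ _) _.
rewrite /norm1 mulr_suml big_seq [leRHS]big_seq; apply: ler_sum => a.
rewrite -mcoeff_neq0 => ha.
by rewrite normrM ler_wpM2l //; apply: h; exists a.
Qed.

Lemma integ_bound q f B : is_prob q ->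
  (forall z, charged q z -> `|f z| <= B) -> `|integ q f| <= B.
Proof.
case=> q0 q1 /integ_norm1; rewrite (_ : norm1 q = 1) ?mul1r //.
by rewrite -q1; apply: eq_bigr => a _; rewrite ger0_norm.
Qed.

Lemma charged_sub q q' z : charged (q - q') z -> charged q z \/ charged q' z.
Proof.
case=> a; rewrite /coef mcoeffB => h <-.
have [q0|q0] := eqVneq (mcoeff a q) 0; last by left; exists a.
right; exists a => //; move: h; rewrite q0 add0r oppr_eq0; exact.
Qed.

Lemma norm1_ge0 q : 0 <= norm1 q.
Proof. exact: sumr_ge0. Qed.

Lemma norm1_0 : norm1 (0 : measure) = 0.
Proof. by rewrite /norm1 msupp0 big_seq_fset0. Qed.

End IntegralBounds.


(** * The differential calculus of functions on words *)

(** A word is a monomial of the free associative algebra on [G], and a function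
    [F] on words is a linear function on that algebra. The boundary of simplices
    is the derivation [d] with [d z = 1] for every letter [z], so
    [d (z u) = u - z (d u)]; chain maps and homotopies that are built letter by
    letter are described by recursion on words, through their effect on [F]. *)

Section Differential.
Context {G : groupType} {V : zmodType}.
Implicit Types (F : seq G -> V) (s : seq G).

(** [F] evaluated at [d s]. *)
Fixpoint delta F s : V :=
  if s is z :: u then F u - delta (fun v => F (z :: v)) u else 0.

Definition kills_degenerate F := forall s, ~~ nondeg s -> F s = 0.

Lemma eq_delta F F' s : F =1 F' -> delta F s = delta F' s.
Proof.
elim: s F F' => //= z u IH F F' h; rewrite h; congr (_ - _).
exact: IH.
Qed.

Lemma deltaD F F' s : delta (fun v => F v + F' v) s = delta F s + delta F' s.
Proof.
elim: s F F' => [|z u IH] F F' /=; first by rewrite addr0.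
by rewrite IH opprD addrACA.
Qed.

Lemma deltaN F s : delta (fun v => - F v) s = - delta F s.
Proof.
by elim: s F => [|z u IH] F /=; [rewrite oppr0 | rewrite IH opprD].
Qed.

Lemma deltaB F F' s : delta (fun v => F v - F' v) s = delta F s - delta F' s.
Proof. by rewrite deltaD deltaN. Qed.

Lemma delta0 s : delta (fun=> 0) s = 0.
Proof. by elim: s => //= z u ->; rewrite subr0. Qed.

Lemma nondeg_cons2 (y z : G) s :
  nondeg (y :: z :: s) = (y != z) && nondeg (z :: s).
Proof. by []. Qed.

Lemma kills_cons F z : kills_degenerate F -> kills_degenerate (fun v => F (z :: v)).
Proof.
move=> h [|y s] hs; first by move: hs.
by apply: h; rewrite nondeg_cons2 negb_and hs orbT.
Qed.

(** The two faces that delete one of two adjacent copies of a letter cancel, and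
    the other faces are degenerate: the boundary descends to normalized
    chains. *)
Lemma delta_kills F : kills_degenerate F -> kills_degenerate (delta F).
Proof.
move=> h s; elim: s F h => [//|z u IH] F h hs.
case: u IH hs => [|y u] IH hs; first by move: hs.
move: (hs); rewrite nondeg_cons2 negb_and negbK.
have kF := kills_cons z h.
case/orP => [/eqP yz|hu]; last first.
  by rewrite -[LHS]/(F (y :: u) - delta _ (y :: u)) (IH _ kF hu) h ?subr0.
have zero v : F [:: z, y & v] = 0 by apply: h; rewrite nondeg_cons2 yz eqxx.
by rewrite /= (eq_delta _ zero) delta0 yz subr0 subrr.
Qed.

End Differential.

Lemma delta_faces {G : groupType} {k : comNzRingType} {V : lmodType k}
    (F : seq G -> V) s :
  delta F s = \sum_(i < size s) (-1) ^+ i *: F (take i s ++ drop i.+1 s).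
Proof.
elim: s F => [|z u IH] F /=; first by rewrite big_ord0.
rewrite big_ord_recl expr0 scale1r /= drop0 IH -sumrN; congr (_ + _).
by apply: eq_bigr => i _; rewrite /= exprS mulN1r scaleNr.
Qed.

Lemma subrACA (A : zmodType) (a b c d : A) : a - b - (c - d) = a - c - (b - d).
Proof. by rewrite !opprB addrACA [RHS]addrACA [- b - c]addrC. Qed.

Section Normalization.
Context {G : groupType} {V : zmodType}.
Implicit Types (F : seq G -> V) (s : seq G).

(** [F] evaluated at [(z1 - z) (z2 - z1) ... (zn - z(n-1))], for
    [s = z1 ... zn]. *)
Fixpoint increments z F s : V :=
  if s is z' :: u then increments z' (fun v => F (z' :: v)) u
                       - increments z' (fun v => F (z :: v)) u
  else F [::].

(** [F] evaluated at [z0 (z1 - z0) ... (zn - z(n-1))]. This element vanishes if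
    the word [z0 ... zn] is degenerate, is congruent to the word modulo
    degenerate ones, and is compatible with [d]: it provides a section, by a
    chain map, of the projection of all chains onto normalized chains. *)
Definition normalize F s : V :=
  if s is z :: u then increments z (fun v => F (z :: v)) u else F [::].

Lemma eq_increments z F F' s : F =1 F' -> increments z F s = increments z F' s.
Proof.
elim: s z F F' => /= [|z' u IH] z F F' h; first exact: h.
by congr (_ - _); apply: IH.
Qed.

Lemma incrementsB z F F' s :
  increments z (fun v => F v - F' v) s = increments z F s - increments z F' s.
Proof.
elim: s z F F' => //= z' u IH z F F'.
by rewrite !(IH z' (fun v => F _) (fun v => F' _)) subrACA.
Qed.

Lemma eq_normalize F F' s : F =1 F' -> normalize F s = normalize F' s.
Proof. by case: s => /= [|z u] h; [apply: h | apply: eq_increments]. Qed.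

Lemma normalizeB F F' s :
  normalize (fun v => F v - F' v) s = normalize F s - normalize F' s.
Proof. by case: s => //= z u; apply: incrementsB. Qed.

(** Words in which a letter is repeated immediately are killed by the factor
    [z - z]. *)
Lemma increments_degenerate z F s : ~~ nondeg (z :: s) -> increments z F s = 0.
Proof.
elim: s z F => [|z' u IH] z F //; rewrite nondeg_cons2.
have [->|_] := eqVneq z z' => /=; first by rewrite subrr.
by move=> h; rewrite !IH // subrr.
Qed.

Lemma normalize_degenerate F : kills_degenerate (normalize F).
Proof. by case=> // z s; apply: increments_degenerate. Qed.

(** Expanding the product, every summand other than the word itself repeats a
    letter where the second term of an increment is first chosen. *)
Lemma increments_id z F s : kills_degenerate F ->
  increments z (fun v => F (z :: v)) s = F (z :: s).
Proof.
elim: s z F => //= z' u IH z F h.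
rewrite (IH z' (fun v => F (z :: v))); last exact: kills_cons.
rewrite [X in _ - X](_ : _ = 0) ?subr0 //.
have : increments z' (fun v => F [:: z, z & v]) u = 0.
  rewrite (@eq_increments _ _ (fun=> 0)).
    by elim: (u) (z') => //= a w IHw b; rewrite IHw subrr.
  by move=> v; apply: h; rewrite nondeg_cons2 eqxx.
by [].
Qed.

Lemma normalize_id F s : kills_degenerate F -> normalize F s = F s.
Proof. by case: s => //= z u h; apply: increments_id. Qed.

(** The factors [z' - z] are cycles, so the differential of their product
    vanishes. *)
Lemma increments_delta z F s : increments z (delta F) s = 0.
Proof.
elim: s z F => //= z' u IH z F.
by rewrite !incrementsB !IH !subr0 subrr.
Qed.

(** Deleting letters from a product of increments telescopes. *)
Lemma delta_increments z F z' s :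
  delta (increments z F) (z' :: s) = increments z' F s.
Proof.
elim: s z F z' => [|y u IH] z F z'; first by rewrite /= subr0.
transitivity (increments z F (y :: u) - delta (fun v =>
    increments z' (fun w => F (z' :: w)) v - increments z' (fun w => F (z :: w)) v)
    (y :: u)); first by [].
rewrite deltaB !IH.
by rewrite /= opprB addrA subrK.
Qed.

Lemma normalize_delta F s : normalize (delta F) s = delta (normalize F) s.
Proof.
case: s => //= z u; rewrite incrementsB increments_delta subr0.
by case: u => [|z' w]; rewrite ?delta_increments //= subr0.
Qed.

Lemma eq_normalize_on F F' s :
  (forall v, size v = size s -> {subset v <= s} -> F v = F' v) ->
  normalize F s = normalize F' s.
Proof.
have aux u z H H' : (forall v, size v = size u -> {subset v <= z :: u} ->
    H v = H' v) -> increments z H u = increments z H' u.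
  elim: u z H H' => /= [|z' u IH] z H H' h; first exact: h.
  congr (_ - _); apply: IH => v sv vu; apply: h; rewrite /= ?sv //.
    move=> y; rewrite !inE => /orP[->|/vu]; first by rewrite ?orbT.
    by rewrite inE => /orP[]->; rewrite ?orbT.
  move=> y; rewrite !inE => /orP[->//|/vu].
  by rewrite inE => /orP[]->; rewrite ?orbT.
case: s => /= [|z u] h; first exact: h.
apply: aux => v sv vu; apply: h; rewrite /= ?sv // => y.
by rewrite inE => /orP[/eqP->|/vu //]; rewrite mem_head.
Qed.

Lemma normalize_act (g : G) F s :
  normalize F [seq (g * y)%g | y <- s]
  = normalize (fun v => F [seq (g * y)%g | y <- v]) s.
Proof.
have aux u z H : increments (g * z)%g H [seq (g * y)%g | y <- u]
    = increments z (fun v => H [seq (g * y)%g | y <- v]) u.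
  by elim: u z H => //= z' u IH z H; rewrite !IH.
by case: s => //= z u; rewrite aux.
Qed.

End Normalization.

Lemma normalize_additive {G : groupType} {V W : zmodType}
    (L : {additive V -> W}) (F : seq G -> V) s :
  L (normalize F s) = normalize (fun v => L (F v)) s.
Proof.
have aux z H u : L (increments z H u) = increments z (fun v => L (H v)) u.
  by elim: u z H => //= z' u IH z H; rewrite raddfB !IH.
by case: s => //= z u; apply: aux.
Qed.

Lemma normalize_bound {G : groupType} {R : numDomainType} (F : seq G -> R) s B :
  (forall v, size v = size s -> {subset v <= s} -> `|F v| <= B) ->
  `|normalize F s| <= 2 ^+ size s * B.
Proof.
have aux u z H : (forall v, size v = size u -> {subset v <= z :: u} ->
    `|H v| <= B) -> `|increments z H u| <= 2 ^+ size u * B.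
  elim: u z H => /= [|z' u IH] z H h; first by rewrite expr0 mul1r; apply: h.
  apply: le_trans (ler_normB _ _) _; rewrite exprS -mulrA mulr2n mulrDl !mul1r.
  apply: lerD; apply: IH => v sv vu; apply: h; rewrite /= ?sv //.
    move=> y; rewrite !inE => /orP[->|/vu]; first by rewrite ?orbT.
    by rewrite inE => /orP[]->; rewrite ?orbT.
  move=> y; rewrite !inE => /orP[->//|/vu].
  by rewrite inE => /orP[]->; rewrite ?orbT.
case: s => /= [|z u] h; first by rewrite expr0 mul1r; apply: h.
have B0 : 0 <= B by apply: le_trans (h (z :: u) _ _).
apply: (@le_trans _ _ (2 ^+ size u * B)); last first.
  by rewrite exprS -mulrA ler_peMl ?mulr_ge0 ?exprn_ge0 ?ler1n.
apply: aux => v sv vu; apply: h; rewrite /= ?sv // => y.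
by rewrite inE => /orP[/eqP->|/vu //]; rewrite mem_head.
Qed.

Section WordFunctions.
Context {G : groupType} {V : lmodType rat}.
Notation measure := (chain rat (@bar G) 1).
Implicit Types (F : seq G -> V) (s : seq G) (Phi Psi : G -> measure).

(** The value of [F] at the image of [s] under the algebra endomorphism [Phi],
    which replaces each letter by a measure. *)
Fixpoint spread Phi F s : V :=
  if s is z :: u
  then integ (Phi z) (fun a => spread Phi (fun v => F (a :: v)) u)
  else F [::].

(** The prism operator [P] between the endomorphisms [Phi] and [Psi], determined
    by [P (z u) = Phi(z) Psi(z) Psi(u) - Phi(z) P(u)]; on [z0 ... zn] it is the
    alternating sum of [Phi(z0 ... zi) Psi(zi ... zn)]. *)
Fixpoint prism Phi Psi F s : V :=
  if s is z :: u then
    integ (Phi z) (fun a =>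
      integ (Psi z) (fun b => spread Psi (fun v => F [:: a, b & v]) u)
      - prism Phi Psi (fun v => F (a :: v)) u)
  else 0.

Lemma delta_integ q (F : G -> seq G -> V) s :
  delta (fun v => integ q (F^~ v)) s = integ q (fun a => delta (F a) s).
Proof.
elim: s F => [|z u IH] F /=; first by rewrite integ0.
by rewrite integB IH.
Qed.

Lemma delta_sum (I : Type) (r : seq I) (F : I -> seq G -> V) s :
  delta (fun v => \sum_(i <- r) F i v) s = \sum_(i <- r) delta (F i) s.
Proof.
elim: r => [|i r IH].
  by rewrite big_nil -[RHS](delta0 s); apply: eq_delta => v; rewrite big_nil.
rewrite big_cons -IH -deltaD; apply: eq_delta => v; exact: big_cons.
Qed.

Lemma eq_spread Phi F F' s : F =1 F' -> spread Phi F s = spread Phi F' s.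
Proof.
elim: s F F' => /= [|z u IH] F F' h; first exact: h.
by apply: eq_integ => a _; apply: IH.
Qed.

Lemma spreadB Phi F F' s :
  spread Phi (fun v => F v - F' v) s = spread Phi F s - spread Phi F' s.
Proof.
elim: s F F' => //= z u IH F F'; rewrite -integB; apply: eq_integ => a _.
exact: IH.
Qed.

Lemma eq_prism Phi Psi F F' s :
  F =1 F' -> prism Phi Psi F s = prism Phi Psi F' s.
Proof.
elim: s F F' => //= z u IH F F' h; apply: eq_integ => a _; congr (_ - _).
  by apply: eq_integ => b _; apply: eq_spread.
exact: IH.
Qed.

Lemma prismB Phi Psi F F' s :
  prism Phi Psi (fun v => F v - F' v) s = prism Phi Psi F s - prism Phi Psi F' s.
Proof.
elim: s F F' => [|z u IH] F F' /=; first by rewrite subr0.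
rewrite -integB; apply: eq_integ => a _.
rewrite [RHS]subrACA -integB -IH; congr (_ - _).
by apply: eq_integ => b _; rewrite spreadB.
Qed.

(** Measures of mass one satisfy [d (Phi z) = 1 = Phi (d z)], so [Phi] commutes
    with the derivation [d]. *)
Lemma spread_delta Phi F s : (forall y, y \in s -> mass (Phi y) = 1) ->
  spread Phi (delta F) s = delta (spread Phi F) s.
Proof.
elim: s F => //= z u IH F m1.
rewrite (delta_integ _ (fun a => spread Phi (fun v => F (a :: v)))).
rewrite -(@integ_cst _ _ (Phi z) (spread Phi F u)) ?m1 ?mem_head //.
rewrite -integB; apply: eq_integ => a _; rewrite -IH -?spreadB //.
by move=> y yu; apply: m1; rewrite inE yu orbT.
Qed.

(** With [P (z u) = Phi(z) Psi(z) Psi(u) - Phi(z) P(u)], the Leibniz rule for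
    [d] reduces [(d P + P d) (z u)] to [Psi(z u) - Phi(z) Psi(u) + Phi(z) (d P +
    P d)(u)]. *)
Lemma prism_delta Phi Psi F s :
  (forall y, y \in s -> mass (Phi y) = 1 /\ mass (Psi y) = 1) ->
  prism Phi Psi (delta F) s + delta (prism Phi Psi F) s
  = spread Psi F s - spread Phi F s.
Proof.
elim: s F => [|z u IH] F m1 /=; first by rewrite addr0 subrr.
have [mF mG] : mass (Phi z) = 1 /\ mass (Psi z) = 1 by apply: m1; rewrite mem_head.
have m1u y : y \in u -> mass (Phi y) = 1 /\ mass (Psi y) = 1.
  by move=> yu; apply: m1; rewrite inE yu orbT.
rewrite (delta_integ _ (fun a v =>
  integ (Psi z) (fun b => spread Psi (fun w => F [:: a, b & w]) v)
  - prism Phi Psi (fun w => F (a :: w)) v)).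
rewrite -(@integ_cst _ _ (Phi z) (prism Phi Psi F u)) //.
rewrite -[X in _ = X - _](@integ_cst _ _ (Phi z)) //.
rewrite -!integB -integD; apply: eq_integ => a _.
rewrite deltaB prismB.
rewrite (delta_integ _ (fun b => spread Psi (fun w => F [:: a, b & w]))).
have -> : integ (Psi z) (fun b => spread Psi (fun v =>
      F (b :: v) - (F (a :: v) - delta (fun w => F [:: a, b & w]) v)) u)
    = integ (Psi z) (fun b => spread Psi (fun v => F (b :: v)) u)
      - (spread Psi (fun v => F (a :: v)) u
         - integ (Psi z) (fun b => delta (spread Psi (fun w => F [:: a, b & w])) u)).
  rewrite -(@integ_cst _ _ (Psi z) (spread Psi (fun v => F (a :: v)) u)) //.
  rewrite -!integB; apply: eq_integ => b _.
  by rewrite !spreadB spread_delta // => y /m1u[].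
have := IH (fun w => F (a :: w)) m1u.
move: (integ _ _) (integ _ _) (prism _ _ F u) (prism _ _ _ u) => Z X p p1.
move: (delta _ u) (spread Psi _ u) (spread Phi _ u) => p2 Y q e.
rewrite !opprB [_ + (p1 - p)]addrA [_ + (p + _)]addrA subrK -2!(addrA X).
congr (X + _); rewrite -(addrA (Z - Y)) (addrA p1) e !addrA subrK.
by rewrite addrAC subrr add0r.
Qed.

Lemma spread_dirac Phi x F s : (forall y, y \in s -> Phi y = cls bar [tuple x]) ->
  spread Phi F s = F (nseq (size s) x).
Proof.
elim: s F => //= z u IH F h; rewrite h ?mem_head // integ_dirac IH // => y yu.
by apply: h; rewrite inE yu orbT.
Qed.

Lemma spread_id Phi F s : (forall y, Phi y = cls bar [tuple y]) ->
  spread Phi F s = F s.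
Proof. by move=> h; elim: s F => //= z u IH F; rewrite h integ_dirac IH. Qed.

(** Every summand of the prism contains [x] twice in succession. *)
Lemma prism_dirac Phi Psi x F s : kills_degenerate F ->
  (forall y, y \in s -> Phi y = cls bar [tuple x]) ->
  (forall y, y \in s -> Psi y = cls bar [tuple x]) -> prism Phi Psi F s = 0.
Proof.
elim: s F => //= z u IH F kF hF hG.
have hFu y : y \in u -> Phi y = cls bar [tuple x].
  by move=> yu; apply: hF; rewrite inE yu orbT.
have hGu y : y \in u -> Psi y = cls bar [tuple x].
  by move=> yu; apply: hG; rewrite inE yu orbT.
rewrite hF ?hG ?mem_head // !integ_dirac (spread_dirac _ hGu) kF; last first.
  by rewrite nondeg_cons2 eqxx.
by rewrite IH ?subrr //; apply: kills_cons.
Qed.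

Lemma spread_act (g : G) Phi Psi F s :
  (forall y, Psi (g * y)%g = act g (Phi y)) ->
  spread Psi F [seq (g * y)%g | y <- s]
  = spread Phi (fun v => F [seq (g * y)%g | y <- v]) s.
Proof.
move=> h; elim: s F => //= z u IH F; rewrite h integ_act.
by apply: eq_integ => a _; rewrite IH.
Qed.

Lemma prism_act (g : G) Phi Psi Phi' Psi' F s :
  (forall y, Phi' (g * y)%g = act g (Phi y)) ->
  (forall y, Psi' (g * y)%g = act g (Psi y)) ->
  prism Phi' Psi' F [seq (g * y)%g | y <- s]
  = prism Phi Psi (fun v => F [seq (g * y)%g | y <- v]) s.
Proof.
move=> h h'; elim: s F => //= z u IH F; rewrite h integ_act.
apply: eq_integ => a _; rewrite IH h' integ_act; congr (_ - _).
by apply: eq_integ => b _; rewrite (spread_act _ _ h').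
Qed.

End WordFunctions.

Section Naturality.
Context {G : groupType} {V W : lmodType rat} (L : {linear V -> W}).
Implicit Types (F : seq G -> V) (s : seq G).

Lemma spread_linear Phi F s : L (spread Phi F s) = spread Phi (fun v => L (F v)) s.
Proof.
elim: s F => //= z u IH F; rewrite integ_comp.
by apply: eq_integ => a _; apply: IH.
Qed.

Lemma prism_linear Phi Psi F s :
  L (prism Phi Psi F s) = prism Phi Psi (fun v => L (F v)) s.
Proof.
elim: s F => [|z u IH] F /=; first exact: linear0.
rewrite integ_comp; apply: eq_integ => a _; rewrite linearB IH; congr (_ - _).
by rewrite integ_comp; apply: eq_integ => b _; rewrite spread_linear.
Qed.

End Naturality.

(** * Estimates for functions on words *)

Section WordEstimates.
Context {G : groupType}.
Notation measure := (chain rat (@bar G) 1).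
Implicit Types (F : seq G -> rat^o) (s : seq G) (B e : rat) (U : G -> Prop).
Implicit Types (Phi Psi : G -> measure).

Definition bounded_on U n F B :=
  forall v, size v = n -> (forall z, z \in v -> U z) -> `|F v| <= B.

Definition carried U s Phi := forall y, y \in s ->
  is_prob (Phi y) /\ forall z, charged (Phi y) z -> U z.

Definition close s e Phi Psi := forall y, y \in s -> norm1 (Phi y - Psi y) <= e.

Lemma bounded_cons U n F B a : bounded_on U n.+1 F B -> U a ->
  bounded_on U n (fun v => F (a :: v)) B.
Proof.
move=> h Ua v sv Uv; apply: h; rewrite /= ?sv // => z.
by rewrite inE => /orP[/eqP->|/Uv].
Qed.

Lemma carried_cons U y s Phi : carried U (y :: s) Phi ->
  [/\ is_prob (Phi y), (forall z, charged (Phi y) z -> U z) & carried U s Phi].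
Proof.
move=> h; have [? ?] := h y (mem_head _ _); split=> // x xs.
by apply: h; rewrite inE xs orbT.
Qed.

Lemma close_cons y s e Phi Psi : close (y :: s) e Phi Psi ->
  norm1 (Phi y - Psi y) <= e /\ close s e Phi Psi.
Proof.
move=> h; split; first exact/h/mem_head.
by move=> x xs; apply: h; rewrite inE xs orbT.
Qed.

Lemma spread_bound U s Phi F B : carried U s Phi -> bounded_on U (size s) F B ->
  `|spread Phi F s| <= B.
Proof.
elim: s F => [|y s IH] F /= => [_ h|]; first exact: h.
move=> /carried_cons[pr hU hs] hB; apply: integ_bound => // a ca.
by apply: IH => //; apply: bounded_cons => //; apply: hU.
Qed.

Lemma prism_bound U s Phi Psi F B : carried U s Phi -> carried U s Psi ->
  bounded_on U (size s).+1 F B -> `|prism Phi Psi F s| <= (size s)%:R * B.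
Proof.
elim: s F => [|y s IH] F /=; first by rewrite normr0 mul0r.
move=> /carried_cons[pr hU hs] /carried_cons[pr' hU' hs'] hB.
apply: integ_bound => // a ca; apply: le_trans (ler_normB _ _) _.
have hBa := bounded_cons hB (hU _ ca).
rewrite -natr1 mulrDl mul1r [leRHS]addrC lerD //; last exact: IH.
apply: integ_bound => // b cb; apply: spread_bound hs' _.
exact: bounded_cons hBa (hU' _ cb).
Qed.

Lemma integ_close U q q' f f' e B B' : norm1 (q - q') <= e -> 0 <= B ->
  is_prob q' -> (forall z, charged q z -> U z) ->
  (forall z, charged q' z -> U z) ->
  (forall z, U z -> `|f z| <= B) -> (forall z, U z -> `|f z - f' z| <= B') ->
  `|integ q (f : G -> rat^o) - integ q' (f' : G -> rat^o)| <= e * B + B'.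
Proof.
move=> he B0 pr hU hU' hB hB'.
rewrite -(subrK (integ q' f) (integ q f)) -addrA -integBl -integB.
apply: le_trans (ler_normD _ _) _; apply: lerD.
  apply: le_trans (integ_norm1 _) _ => [z /charged_sub [/hU|/hU']|]; try exact: hB.
  exact: ler_wpM2r.
by apply: integ_bound => // z /hU'; apply: hB'.
Qed.

Lemma spread_close U s Phi Psi F e B : 0 <= B ->
  carried U s Phi -> carried U s Psi -> close s e Phi Psi ->
  bounded_on U (size s) F B ->
  `|spread Phi F s - spread Psi F s| <= (size s)%:R * (e * B).
Proof.
move=> B0; elim: s F => [|y s IH] F /=; first by rewrite subrr normr0 mul0r.
move=> /carried_cons[pr hU hs] /carried_cons[pr' hU' hs'] /close_cons[he hes] hB.
rewrite -natr1 mulrDl mul1r [leRHS]addrC; apply: (@integ_close U) => // a Ua.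
  by apply: spread_bound hs _; apply: bounded_cons.
by apply: IH => //; apply: bounded_cons.
Qed.

(** Replacing the measures one letter at a time, each replacement costs the
    distance of the two measures; a prism of length [n] contains [n (n + 1)]
    letters. *)
Lemma prism_close U s Phi Psi Phi' Psi' F e B : 0 <= B ->
  carried U s Phi -> carried U s Psi -> carried U s Phi' -> carried U s Psi' ->
  close s e Phi Phi' -> close s e Psi Psi' -> bounded_on U (size s).+1 F B ->
  `|prism Phi Psi F s - prism Phi' Psi' F s|
  <= (size s * (size s).+1)%:R * (e * B).
Proof.
move=> B0; elim: s F => [|y s IH] F /=; first by rewrite subrr normr0 mul0r.
move=> /carried_cons[p1 u1 s1] /carried_cons[p2 u2 s2].
move=> /carried_cons[p3 u3 s3] /carried_cons[p4 u4 s4].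
move=> /close_cons[e1 es1] /close_cons[e2 es2] hB.
have -> : ((size s).+1 * (size s).+2)%:R * (e * B) =
  e * ((size s).+1%:R * B) + (e * B + (size s)%:R * (e * B)
    + (size s * (size s).+1)%:R * (e * B)) :> rat.
  by rewrite !natrM -!natr1; ring.
apply: (@integ_close U) => // [|a Ua|a Ua]; first exact: mulr_ge0.
  apply: le_trans (ler_normB _ _) _; rewrite -natr1 mulrDl mul1r [leRHS]addrC.
  have hBa := bounded_cons hB Ua; apply: lerD; last exact: prism_bound hBa.
  apply: integ_bound => // b /u2 Ub; apply: spread_bound s2 _.
  exact: bounded_cons hBa Ub.
have hBa := bounded_cons hB Ua.
rewrite subrACA; apply: le_trans (ler_normB _ _) _; apply: lerD; last exact: IH.
apply: (@integ_close U) => // b Ub; have hBab := bounded_cons hBa Ub.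
  exact: spread_bound s2 hBab.
exact: spread_close s2 s4 es2 hBab.
Qed.

End WordEstimates.

(** * The word metric *)

Section WordMetric.
Context {G : groupType} (S : {fset G}).
Hypotheses (symS : symmetric_subset S) (genS : generating S).
Implicit Types (g x y z : G) (w : seq G).
Notation dist := (word_dist S).

Lemma word_lengthP g : exists2 w, represents S w g & size w = word_length S g.
Proof.
rewrite /word_length; case: pselect => [e|[]]; last first.
  by have [w wg] := genS g; exists (size w); apply/asboolP; exists w.
by case: ex_minnP => n /asboolP[w [<- wg]] _; exists w.
Qed.

Lemma word_length_le w g : represents S w g -> (word_length S g <= size w)%N.
Proof.
move=> wg; rewrite /word_length; case: pselect => // e.
by case: ex_minnP => n _; apply; apply/asboolP; exists w.
Qed.

Lemma word_length1 : word_length S 1%g = 0%N.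
Proof.
apply/eqP; rewrite -leqn0; apply: (@word_length_le [::]).
by split=> //; rewrite big_nil.
Qed.

Lemma word_lengthM g h :
  (word_length S (g * h)%g <= word_length S g + word_length S h)%N.
Proof.
have [w [wS <-] <-] := word_lengthP g; have [v [vS <-] <-] := word_lengthP h.
rewrite -size_cat; apply: word_length_le; split; last by rewrite big_cat.
by move=> a; rewrite mem_cat => /orP[/wS|/vS].
Qed.

Lemma word_lengthV g : word_length S g^-1%g = word_length S g.
Proof.
suff le h : (word_length S h^-1%g <= word_length S h)%N.
  by apply/eqP; rewrite eqn_leq le -{1}[g]invgK le.
have [w [wS <-] <-] := word_lengthP h.
rewrite -(size_map (fun a : G => a^-1%g)) -size_rev; apply: word_length_le; split.
  by move=> a; rewrite mem_rev => /mapP[b /wS bS ->]; apply: symS.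
elim: (w) => [|a u IH]; first by rewrite !big_nil invg1.
by rewrite map_cons rev_cons -cats1 big_cat IH /= big_seq1 big_cons invgM.
Qed.

Lemma word_dist0 x : dist x x = 0%N.
Proof. by rewrite /word_dist mulVg word_length1. Qed.

Lemma word_dist_eq0 x y : dist x y = 0%N -> x = y.
Proof.
rewrite /word_dist => xy; have [w [_ wg]] := word_lengthP (x^-1 * y)%g.
rewrite xy => /size0nil w0; move: wg; rewrite w0 big_nil => /(congr1 (fun h => x * h)%g).
by rewrite mulg1 mulVKg.
Qed.

Lemma word_distC x y : dist x y = dist y x.
Proof. by rewrite /word_dist -word_lengthV invgM invgK. Qed.

Lemma word_dist_tri y x z : (dist x z <= dist x y + dist y z)%N.
Proof.
rewrite /word_dist (_ : (x^-1 * z = (x^-1 * y) * (y^-1 * z))%g); last first.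
  by rewrite mulgA mulgK.
exact: word_lengthM.
Qed.

Lemma word_dist_mul g x y : dist (g * x)%g (g * y)%g = dist x y.
Proof. by rewrite /word_dist invgM -mulgA mulKg. Qed.

Lemma word_dist_prod x w : {subset w <= S} ->
  (dist x (x * \prod_(a <- w) a)%g <= size w)%N.
Proof. by move=> wS; rewrite /word_dist mulKg; apply: word_length_le. Qed.

(** [S] is finite, and so is the set of words of bounded length in [S]. *)
Lemma finite_ball n : exists L : seq G, forall g, (word_length S g <= n)%N -> g \in L.
Proof.
elim: n => [|n [L hL]].
  exists [:: 1%g] => g; rewrite leqn0 => /eqP g0.
  have [w [_ wg]] := word_lengthP g; rewrite g0 -wg => /size0nil ->.
  by rewrite big_nil mem_head.
exists (L ++ [seq (s * a)%g | s <- enum_fset S, a <- L]) => g hg.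
have [w [wS wg] sw] := word_lengthP g; rewrite mem_cat -wg.
rewrite -sw in hg; case: w wS wg sw hg => [|s w] wS wg sw hg.
  by rewrite big_nil hL // word_length1.
apply/orP; right; apply/allpairsP; exists (s, \prod_(a <- w) a)%g.
rewrite /= big_cons; split=> //; first exact: (wS s (mem_head _ _)).
apply: hL; apply: leq_trans (word_length_le _) _; last first.
  exact: hg.
by split=> // a aw; apply: wS; rewrite inE aw orbT.
Qed.

Lemma finite_words_bound (L : seq G) n (f : seq G -> nat) :
  exists B, forall s, size s = n -> {subset s <= L} -> (f s <= B)%N.
Proof.
elim: n f => [|n IH] f; first by exists (f [::]) => s /size0nil ->.
have h a : exists B, forall s, size s = n -> {subset s <= L} ->
  (f (a :: s) <= B)%N by exact: IH.
have [B hB] := choice h; exists (\max_(a <- L) B a)%N => -[|a s] // [ss] sL.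
apply: leq_trans (hB a s ss _) _; first by move=> x xs; apply: sL; rewrite inE xs orbT.
by apply: (@leq_bigmax_seq _ _ _ (fun a => B a)) => //; apply: sL; rewrite mem_head.
Qed.

(** Up to translation there are only finitely many words of given length and
    diameter. *)
Lemma bounded_words_bound n D (P : nat -> seq G -> Prop) :
  (forall m m' s, (m <= m')%N -> P m s -> P m' s) ->
  (forall g m s, P m s -> P m [seq (g * a)%g | a <- s]) ->
  (forall s, exists m, P m s) ->
  exists B, forall x s, size s = n -> (forall y, y \in s -> (dist x y <= D)%N) ->
    P B s.
Proof.
move=> mono inv /choice[f hf]; have [L hL] := finite_ball D.
have [B hB] := finite_words_bound L n f; exists B => x s ss hs.
have -> : s = [seq (x * a)%g | a <- [seq (x^-1 * a)%g | a <- s]].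
  by rewrite -map_comp map_id_in // => a _; exact: mulVKg.
apply/inv/(mono _ _ _ _ (hf _))/hB; first by rewrite size_map.
by move=> _ /mapP[y /hs xy ->]; apply: hL.
Qed.

End WordMetric.

(** * Geodesics in the Cayley graph *)

Section NearPoints.
Context {K : realType} {X : Type} (d : X -> X -> K).

Lemma nbhd_of_near (Y : set X) (e e' : K) x : e < e' -> nbhd_of d Y e x ->
  exists2 y, Y y & d x y < e'.
Proof.
move=> ee' /= h; have /ereal_inf_lt : (ereal_inf [set (d x y)%:E | y in Y] < e'%:E)%E.
  by apply: le_lt_trans h _; rewrite lte_fin.
by case=> _ [y Yy <-]; rewrite lte_fin; exists y.
Qed.

Lemma near_nbhd_of (Y : set X) (e : K) x y : Y y -> d x y <= e -> nbhd_of d Y e x.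
Proof.
move=> Yy xy; rewrite /nbhd_of /=; apply: (@le_trans _ _ (d x y)%:E).
  by apply: ereal_inf_lbound; exists y.
by rewrite lee_fin.
Qed.

End NearPoints.

Section CayleyGeodesics.
Context {K : realType} {G : groupType} (S : {fset G}).
Hypotheses (symS : symmetric_subset S) (genS : generating S).
Notation dist := (word_dist S).
Notation point := (cayley_point K S).
Implicit Types (p q : point) (x y z g : G) (u : seq G).

Definition base p : G := match p with Vertex g => g | EdgePoint g _ _ => g end.

Definition lengths p q : set K :=
  edge_paths p q `|`
       [set l | exists e f, [/\ e \in exits p, f \in exits q &
                  l = e.2 + word_metric K S e.1 f.1 + f.2]].

Lemma generator_dist g (s : S) : (dist g (g * \val s)%g <= 1)%N.
Proof.
have := @word_dist_prod G S g [:: \val s]; rewrite big_seq1; apply.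
by move=> a; rewrite inE => /eqP ->; apply: valP.
Qed.

Lemma exits_base p e : e \in exits p -> 0 <= e.2 /\ (dist (base p) e.1 <= 1)%N.
Proof.
case: p => [g|g s t] /=; first by rewrite inE => /eqP ->; rewrite word_dist0.
rewrite !inE => /orP[] /eqP -> /=; first by rewrite word_dist0.
by split; [rewrite subr_ge0 | apply: generator_dist].
Qed.

Lemma exits_nonempty p : exists e, e \in exits p.
Proof. by case: p => [g|g s t]; eexists; apply: mem_head. Qed.

Lemma lengths_nonempty p q : lengths p q !=set0.
Proof.
have [e ep] := exits_nonempty p; have [f fq] := exits_nonempty q.
by eexists; right; exists e, f.
Qed.

Lemma lengths_ge0 p q : lbound (lengths p q) 0.
Proof.
move=> l [|[e [f [/exits_base[e0 _] /exits_base[f0 _] ->]]]].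
  by case: p q => // g s t [//|g' s' t'] [[_ ->]|[_ ->]].
by rewrite addr_ge0 // addr_ge0.
Qed.

Lemma cayley_dist_le p q l : lengths p q l -> cayley_dist p q <= l.
Proof. by apply: ge_inf; exists 0; apply: lengths_ge0. Qed.

Lemma cayley_dist_ge p q l : lbound (lengths p q) l -> l <= cayley_dist p q.
Proof. by apply: lb_le_inf; apply: lengths_nonempty. Qed.

(** A connection of two points begins and ends on their edges, so replacing the
    points by vertices of these edges costs at most one at each end. With this
    comparison, triangles can be estimated in the word metric alone. *)
Lemma base_dist_le p q : (dist (base p) (base q))%:R <= cayley_dist p q + 2.
Proof.
rewrite -lerBlDr; apply: cayley_dist_ge => l [|]; last first.
  case=> e [f [/exits_base[e0 e1] /exits_base[f0 f1] ->]].
  have : (dist (base p) (base q) <= dist e.1 f.1 + 2)%N.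
    have := word_dist_tri genS e.1 (base p) (base q).
    have := word_dist_tri genS f.1 e.1 (base q).
    rewrite (word_distC symS genS f.1); lia.
  rewrite -(ler_nat K) natrD /word_metric; lra.
have abs (a b : K) : 0 <= `|a - b| by [].
case: p q => // g s t [//|g' s' t'] [[[-> ->] ->]|[[-> h _] ->]] /=.
  by rewrite word_dist0; have := abs t%:num t'%:num; lra.
have := generator_dist g s; rewrite -(ler_nat K).
have := abs t%:num (1 - t'%:num); lra.
Qed.

Section Path.
Context (x : G) (u : seq G).
Hypotheses (uS : {subset u <= S}) (ug : size u = dist x (x * \prod_(a <- u) a)%g).

Definition station i : G := (x * \prod_(a <- take i u) a)%g.

Lemma station0 : station 0 = x.
Proof. by rewrite /station take0 big_nil mulg1. Qed.

Lemma stationS i : (i < size u)%N -> station i.+1 = (station i * nth 1%g u i)%g.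
Proof. by move=> iu; rewrite /station (take_nth 1%g) // -cats1 big_cat big_seq1 mulgA. Qed.

Lemma station_le i j : (i <= j)%N -> (dist (station i) (station j) <= j - i)%N.
Proof.
move=> ij; rewrite /station -(subnKC ij) takeD big_cat mulgA.
apply: leq_trans (word_dist_prod _ _) _ => //.
  by move=> a /mem_take /mem_drop /uS.
by rewrite size_take; case: ifP; lia.
Qed.

Lemma station_dist i j : (i <= j <= size u)%N ->
  dist (station i) (station j) = (j - i)%N.
Proof.
move=> /andP[ij ju]; apply/eqP; rewrite eqn_leq station_le //.
have := station_le (leq0n i); have := station_le ju.
have := word_dist_tri genS (station i) (station 0) (station (size u)).
have := word_dist_tri genS (station j) (station i) (station (size u)).
have <- : size u = dist (station 0) (station (size u)).
  by rewrite station0 /station take_size.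
lia.
Qed.

Lemma station_metric i j : (i <= size u)%N -> (j <= size u)%N ->
  word_metric K S (station i) (station j) = `|i%:R - j%:R|.
Proof.
move=> iu ju; rewrite /word_metric; have [ij|/ltnW ij] := leqP i j.
  by rewrite station_dist ?ij // natrB // distrC ger0_norm // subr_ge0 ler_nat.
rewrite word_distC // station_dist ?ij // natrB // ger0_norm //.
by rewrite subr_ge0 ler_nat.
Qed.

Lemma station_inj i j : (i <= size u)%N -> (j <= size u)%N ->
  station i = station j -> i = j.
Proof.
move=> iu ju e; have := station_metric iu ju.
rewrite e /word_metric word_dist0 => /esym/eqP; rewrite normr_eq0 subr_eq0 eqr_nat.
by move/eqP.
Qed.

(** A point of the graph has several names, any of which may occur in
    [cayley_dist]; hence a relation between times and names instead of a
    parametrization of the path. *)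
Definition at_time (t : K) p : Prop :=
  exists2 i, (i <= size u)%N &
    (p = Vertex (station i) /\ t = i%:R) \/
    exists s tau, [/\ (i < size u)%N, \val s = nth 1%g u i,
      p = EdgePoint (station i) s tau & t = i%:R + tau%:num].

Lemma at_time_exits t p e : at_time t p -> e \in exits p ->
  exists a, [/\ (a <= size u)%N, e.1 = station a & e.2 = `|t - a%:R|].
Proof.
case=> i iu [[-> ->]|[s [tau [iu' si -> ->]]]] /=.
  by rewrite inE => /eqP ->; exists i; rewrite subrr normr0.
rewrite !inE => /orP[] /eqP -> /=.
  by exists i; rewrite addrC addKr // ger0_norm.
exists i.+1; rewrite stationS // si; split=> //.
have : 0 <= tau%:num by [].
have : tau%:num <= 1 by [].
by move=> *; rewrite -natr1 ler0_norm; lra.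
Qed.

Lemma at_time_neighbours t p : at_time t p -> exists lo hi,
  [/\ (lo <= hi <= size u)%N, (lo%:R <= t <= hi%:R),
   (station lo, t - lo%:R) \in exits p, (station hi, hi%:R - t) \in exits p &
   hi = lo \/ hi = lo.+1 /\ exists s tau, [/\ \val s = nth 1%g u lo,
      p = EdgePoint (station lo) s tau & t = lo%:R + tau%:num]].
Proof.
case=> i iu [[-> ->]|[s [tau [iu' si -> ->]]]].
  by exists i, i; rewrite !subrr !lexx leqnn iu !mem_head; split=> //; left.
exists i, i.+1; rewrite iu' leqnSn /= stationS // si -natr1.
have t1 : tau%:num <= 1 by [].
have t0 : 0 <= tau%:num by [].
split; first by [].
- by apply/andP; lra.
- by rewrite addrC addKr mem_head.
- by rewrite opprD addrACA subrr add0r !inE eqxx orbT.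
- by right; split=> //; exists s, tau.
Qed.

(** The upper bound comes from the path itself: the two points lie on a common
    edge, or one passes from the later neighbouring vertex of the first point to
    the earlier one of the second. For the lower bound, a connection of the two
    points leaves and enters through vertices of the path, whose distances are
    the differences of times. *)
Lemma at_time_dist t t' p p' : at_time t p -> at_time t' p' ->
  cayley_dist p p' = `|t - t'|.
Proof.
move=> hp hp'; apply/eqP; rewrite eq_le; apply/andP; split.
  have [lo [hi [/andP[lh hu] /andP[lt th] lp hip hE]]] := at_time_neighbours hp.
  have [lo' [hi' [/andP[lh' hu'] /andP[lt' th'] lp' hip' hE']]] :=
    at_time_neighbours hp'.
  have [hl|lh1] := leqP hi lo'.
    have -> : `|t - t'| = (hi%:R - t) + word_metric K S (station hi) (station lo')
        + (t' - lo'%:R).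
      rewrite station_metric ?(leq_trans lh') //.
      have := hl; rewrite -(ler_nat K) => ?.
      by rewrite !ler0_norm; lra.
    by apply: cayley_dist_le; right; exists (station hi, hi%:R - t),
      (station lo', t' - lo'%:R).
  have [hl|lh2] := leqP hi' lo.
    have -> : `|t - t'| = (t - lo%:R) + word_metric K S (station lo) (station hi')
        + (hi'%:R - t').
      rewrite station_metric ?(leq_trans lh) //.
      have := hl; rewrite -(ler_nat K) => ?.
      by rewrite !ger0_norm; lra.
    by apply: cayley_dist_le; right; exists (station lo, t - lo%:R),
      (station hi', hi'%:R - t').
  (* Neither point passes the edge of the other, so both lie on one edge. *)
  have hl : (hi <= lo.+1)%N by case: hE => [->|[-> _]].
  have hl' : (hi' <= lo'.+1)%N by case: hE' => [->|[-> _]].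
  have ll : lo = lo' by clear - lh1 lh2 hl hl'; lia.
  case: hE => [hE|[_ [s [tau [si -> ->]]]]]; first by clear - hE ll lh1 lh2; lia.
  case: hE' => [hE'|[_ [s' [tau' [si' -> ->]]]]]; first by clear - hE' ll lh1 lh2; lia.
  apply: cayley_dist_le; left; left; rewrite -ll; split; last by congr `|_|; lra.
  by split=> //; apply: val_inj; rewrite si si' ll.
apply: cayley_dist_ge => l [|]; last first.
  case=> e [f [/(at_time_exits hp)[a [au -> ->]]]].
  move=> /(at_time_exits hp')[b [bu -> ->]] ->; rewrite station_metric //.
  rewrite [X in _ <= _ + X]distrC.
  have := ler_normD (t - a%:R + (a%:R - b%:R)) (b%:R - t').
  have := ler_normD (t - a%:R) (a%:R - b%:R).
  by rewrite (_ : t - a%:R + (a%:R - b%:R) + (b%:R - t') = t - t'); [lra | ring].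
case: hp hp' => i iu [[-> ->//]|[s [tau [iu' si -> ->]]]].
case=> j ju [[-> ->//]|[s' [tau' [ju' sj -> ->]]]] [[[e _] ->]|[[e1 e2 _] _]].
  have <- := station_inj ju iu e.
  by rewrite [X in X <= _](_ : _ = `|tau%:num - tau'%:num|) //; congr `|_|; lra.
move: e1; rewrite si -stationS // => /(station_inj ju iu') ej.
have := stationS iu'; rewrite -si => e3.
have := stationS ju'; rewrite -sj e2 [X in _ = (station X * _)%g]ej e3 mulgK => e.
by have := station_inj ju' iu e; lia.
Qed.

Lemma at_time_ex t : 0 <= t <= (size u)%:R -> exists p, at_time t p.
Proof.
move=> /andP[t0 tu]; have /andP[it ti] := truncn_itv t0.
have [iu|iu] := ltnP (Num.truncn t) (size u); last first.
  exists (Vertex (station (size u))), (size u) => //; left; split=> //.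
  apply/eqP; rewrite eq_le tu /=; apply: le_trans it; rewrite ler_nat //.
have tau0 : 0 <= t - (Num.truncn t)%:R by rewrite subr_ge0.
have tau1 : t - (Num.truncn t)%:R <= 1 by rewrite lerBlDr addrC natr1 ltW.
pose s := [` uS (mem_nth 1%g iu)]%fset; pose tau := Itv01 tau0 tau1.
exists (EdgePoint (station (Num.truncn t)) s tau).
exists (Num.truncn t); first exact: ltnW.
right; exists s, tau; split=> //=.
by rewrite addrC subrK.
Qed.

(** The endpoints of a geodesic segment must be the given vertices themselves
    and not other names of them; the remaining points are chosen arbitrarily, so
    that a vertex of the path is only found up to the length of an edge. *)
Lemma geodesic_path : exists2 A : set point,
  geodesic_segment cayley_dist (Vertex x) (Vertex (x * \prod_(a <- u) a)%g) A &
  (forall p, A p -> exists2 i, (i <= size u)%N & base p = station i) /\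
  (forall i, (i <= size u)%N -> exists2 p, A p & (dist (station i) (base p) <= 1)%N).
Proof.
have a0 : at_time 0 (Vertex x) by exists 0%N => //; left; rewrite station0.
have aL : at_time (size u)%:R (Vertex (x * \prod_(a <- u) a)%g).
  by exists (size u) => //; left; rewrite /station take_size.
have dL : cayley_dist (Vertex x : point) (Vertex (x * \prod_(a <- u) a)%g) = (size u)%:R.
  by rewrite (at_time_dist a0 aL) sub0r normrN ger0_norm.
have /choice[c hc] : forall t, exists p, 0 <= t <= (size u)%:R ->
    at_time t p /\ (t = 0 -> p = Vertex x) /\
    (t = (size u)%:R -> p = Vertex (x * \prod_(a <- u) a)%g).
  move=> t; have [->|t0] := eqVneq t 0.
    exists (Vertex x) => _; split=> //; split=> // /esym/eqP; rewrite pnatr_eq0.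
    by move=> /eqP/size0nil ->; rewrite big_nil mulg1.
  have [tE|tL] := eqVneq t (size u)%:R.
    exists (Vertex (x * \prod_(a <- u) a)%g) => _; rewrite {1}tE; split=> //.
    by split=> // e; move: t0; rewrite e eqxx.
  have [ht|ht] := boolP (0 <= t <= (size u)%:R); last by exists (Vertex x).
  have [p hp] := at_time_ex ht; exists p => _; split=> //.
  by split=> e; [move: t0 | move: tL]; rewrite e eqxx.
have in01 (t : K) : t \in `[0, (size u)%:R] -> 0 <= t <= (size u)%:R by rewrite in_itv.
exists (c @` [set` `[0, (size u)%:R]]).
  exists c; rewrite dL; split=> //.
  - by have [|_ [->]] := hc 0; rewrite ?lexx ?ler0n.
  - by have [|_ [_ ->]] := hc (size u)%:R; rewrite ?lexx ?ler0n.
  - move=> s t /in01 /hc[hs _] /in01 /hc[ht _]; exact: at_time_dist.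
split=> [_ [t /in01 /hc[[i iu h] _] <-]|i iu].
  exists i => //; case: h => [[-> _]|[s [tau [_ _ -> _]]]] //.
exists (c i%:R); first by exists i%:R => //=; rewrite in_itv /= ler0n ler_nat.
have iu' : 0 <= (i%:R : K) <= (size u)%:R.
  by apply/andP; split; rewrite ?ler0n ?ler_nat.
have [[j ju h] _] := hc _ iu'.
case: h => [[-> /eqP]|[s [tau [ju' _ -> e]]]] /=.
  by rewrite eqr_nat => /eqP ->; rewrite word_dist0.
have t1 : tau%:num <= 1 by [].
have t0 : 0 <= tau%:num by [].
have ji : (j <= i <= j.+1)%N.
  by rewrite -(ler_nat K) -(ler_nat K i) -natr1 e; apply/andP; lra.
by rewrite word_distC // station_dist; lia.
Qed.

Lemma station_geodesic i : (i <= size u)%N ->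
  (dist x (station i) + dist (station i) (station (size u)) = dist x (station (size u)))%N.
Proof. by move=> iu; rewrite -station0 !station_dist ?iu ?leqnn //; lia. Qed.

End Path.

Section Combing.
Context (w : G -> seq G) (wG : geodesic_words S w).
Notation word x y := (w (x^-1 * y)%g).

Lemma wordS x y : {subset word x y <= S}.
Proof. by have [[wS _] _] := wG (x^-1 * y)%g. Qed.

Lemma word_prod x y : (x * \prod_(a <- word x y) a = y)%g.
Proof. by have [[_ ->] _] := wG (x^-1 * y)%g; rewrite mulVKg. Qed.

Lemma size_word x y : size (word x y) = dist x (x * \prod_(a <- word x y) a)%g.
Proof. by rewrite word_prod; have [_ ->] := wG (x^-1 * y)%g. Qed.

Lemma station_word_geodesic x y i : (i <= size (word x y))%N ->
  (dist x (station x (word x y) i) + dist (station x (word x y) i) y = dist x y)%N.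
Proof.
move=> iu; have := station_geodesic (@wordS x y) (@size_word x y) iu.
suff -> : station x (word x y) (size (word x y)) = y by [].
by rewrite /station take_size word_prod.
Qed.

Lemma near_station x y z (e : nat) :
  nbhd_of cayley_dist (chosen_geodesic w x y : set point) e%:R (Vertex z) ->
  exists2 i, (i <= size (word x y))%N &
    (dist z (station x (word x y) i) <= e + 2)%N.
Proof.
have lt : (e%:R : K) < e%:R + 1 by rewrite ltrDl.
move=> /(nbhd_of_near lt)[p hp zp].
have [i iu pE] : exists2 i, (i <= size (word x y))%N & base p = station x (word x y) i.
  case: hp => [->|[i [s [t [iu _ ->]]]]]; first by exists 0%N; rewrite ?station0.
  by exists i => //; apply: ltnW.
exists i => //; rewrite -pE -ltnS -(ltr_nat K) -addnS natrD.
by apply: le_lt_trans (base_dist_le (Vertex z) p) _; rewrite (natrD _ 1 2); lra.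
Qed.

(** A vertex of the geodesic from [x] to [y] is close to one of the other two
    sides of the triangle with third vertex [z], and on that side distances to
    the endpoints add up. The neighbourhoods are defined by an infimum, so [e]
    is exceeded by less than one; two more are lost by passing from points to
    vertices, and one for the vertex that is known up to an edge only. *)
Lemma station_thin (e : nat) x y z i :
  hyperbolic (cayley_dist : point -> point -> K) e%:R ->
  (i <= size (word x y))%N -> let u := station x (word x y) i in
  (dist u z + dist y u <= dist y z + 2 * (e + 3))%N \/
  (dist u z + dist x u <= dist x z + 2 * (e + 3))%N.
Proof.
move=> hyp iu u.
have [A gA [_ hA]] := geodesic_path (@wordS x y) (@size_word x y).
have [B gB [hB _]] := geodesic_path (@wordS y z) (@size_word y z).
have [C gC [hC _]] := geodesic_path (@wordS z x) (@size_word z x).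
rewrite !word_prod in gA gB gC; have [sub _ _] := hyp _ _ _ _ _ _ gA gB gC.
have [p Ap up] := hA _ iu.
have lt : (e%:R : K) < e%:R + 1 by rewrite ltrDl.
have [q BCq pq] := nbhd_of_near lt (sub _ Ap).
have pq' : (dist (base p) (base q) <= e + 2)%N.
  rewrite -ltnS -(ltr_nat K) -addnS natrD.
  by apply: le_lt_trans (base_dist_le p q) _; rewrite (natrD _ 1 2); lra.
rewrite -/u in up.
have uq := word_dist_tri genS (base p) u (base q).
have uz := word_dist_tri genS (base q) u z.
have yu := word_dist_tri genS (base q) y u.
have xu := word_dist_tri genS (base q) x u.
rewrite (word_distC symS genS (base q) u) in yu xu.
case: BCq => [/hB|/hC] [j ju qj]; have := station_word_geodesic ju; rewrite -qj.
  by left; lia.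
rewrite (word_distC symS genS z x) (word_distC symS genS z (base q)).
rewrite (word_distC symS genS (base q) x) => ?; right; lia.
Qed.

(** The form in which hyperbolicity is used: [z] is replaced by a vertex of the
    geodesic, at the cost of [e + 2] for each of the two distances of [z] on the
    left, and the vertex satisfies the estimate with [2 * (e + 3)]. *)
Lemma near_geodesic_thin (e : nat) x y z :
  hyperbolic (cayley_dist : point -> point -> K) e%:R ->
  nbhd_of cayley_dist (chosen_geodesic w x y : set point) e%:R (Vertex z) ->
  (exists v, (dist x v + dist v y = dist x y)%N /\ (dist z v <= 4 * (e + 3))%N) /\
  forall z', (dist z z' + dist y z <= dist y z' + 4 * (e + 3))%N \/
             (dist z z' + dist x z <= dist x z' + 4 * (e + 3))%N.
Proof.
move=> hyp /near_station[i iu zu]; split.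
  exists (station x (word x y) i); rewrite station_word_geodesic //.
  by split=> //; lia.
move=> z'; have := station_thin z' hyp iu => /=.
set u := station _ _ _ in zu *.
have := word_dist_tri genS u z z'; have := word_dist_tri genS u x z.
have := word_dist_tri genS u y z; rewrite (word_distC symS genS u z); lia.
Qed.

End Combing.
End CayleyGeodesics.

(** * Rational coefficients *)

(** A maximal rational subspace avoiding [1] is a complement of the line of the
    rationals; [p] is the projection along it. *)
Lemma rational_projection (F : numFieldType) :
  exists p : F -> rat, p 1 = 1 /\ forall x y, p (x + y) = p x + p y.
Proof.
pose P (A : set F) := (forall x y (q : rat), A x -> A y -> A (x + ratr q * y)) /\ ~ A 1.
have [|A [[lin A1] maxA]] := @Zorn_bigcup F P.
  move=> C CP tot; split=> [x y q [X CX Xx] [Y CY Yy]|[X CX]]; last first.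
    by have [_] := CP _ CX.
  have [XY|YX] := tot _ _ CX CY.
    by exists Y => //; apply: (CP _ CY).1 => //; apply: XY.
  by exists X => //; apply: (CP _ CX).1 => //; apply: YX.
have A0 : A 0.
  apply: contrapT => nA0; have nA x : ~ A x.
    move=> Ax; apply: nA0; have := lin x x (- 1) Ax Ax.
    by rewrite rmorphN rmorph1 mulN1r subrr.
  apply: (maxA [set 0]).
    split=> [x /nA //|]; move/(_ 0 erefl); exact: nA.
  split=> [x y q -> ->|/eqP]; first by rewrite mulr0 addr0.
  by rewrite oner_eq0.
have AZ q x : A x -> A (ratr q * x) by move=> Ax; rewrite -[_ * x]add0r; apply: lin.
have AD x y : A x -> A y -> A (x + y).
  by move=> Ax Ay; have := lin x y 1 Ax Ay; rewrite rmorph1 mul1r.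
have AN x : A x -> A (- x) by move=> /(AZ (-1)); rewrite rmorphN rmorph1 mulN1r.
have ex z : exists q : rat, A (z - ratr q).
  have [Az|nAz] := pselect (A z); first by exists 0; rewrite rmorph0 subr0.
  pose B := [set v | exists q m, A m /\ v = m + ratr q * z].
  have nB1 : ~ ~ B 1.
    move=> nB1; apply: (maxA B).
      split=> [x Ax|]; first by exists 0, x; rewrite rmorph0 mul0r addr0.
      by move/(_ z) => h; apply/nAz/h; exists 1, 0; rewrite rmorph1 mul1r add0r.
    split=> // _ _ q [a [m [Am ->]]] [b [n [An ->]]].
    exists (a + q * b), (m + ratr q * n); split; first exact: lin.
    by rewrite rmorphD rmorphM /=; ring.
  have [q [m [Am e]]] := contrapT nB1.
  have q0 : q != 0.
    apply/eqP => q0; apply: A1; move: e; rewrite q0 rmorph0 mul0r addr0 => ->.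
    exact: Am.
  have rq0 : ratr q != 0 :> F by rewrite fmorph_eq0.
  have zE : z = (1 - m) / ratr q by rewrite e addrC addKr [ratr q * z]mulrC mulfK.
  have rV : ratr q^-1 = (ratr q)^-1 :> F by exact: fmorphV.
  exists q^-1; rewrite (_ : z - _ = ratr (- q^-1) * m); first exact: AZ.
  by rewrite rmorphN /= rV {1}zE; ring.
have [p hp] := choice ex.
have uniq z q : A (z - ratr q) -> p z = q.
  move=> hq; apply/eqP; rewrite -subr_eq0; apply/eqP; apply: contrapT => /eqP pq.
  apply: A1; have rpq : ratr (p z - q) != 0 :> F by rewrite fmorph_eq0.
  rewrite -(mulVf rpq) -fmorphV; apply: AZ.
  have := AD _ _ hq (AN _ (hp z)).
  by rewrite opprB addrC addrA subrK -rmorphB.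
exists p; split=> [|x y]; apply: uniq; first by rewrite rmorph1 subrr.
by rewrite rmorphD opprD addrACA; apply: AD.
Qed.

Section Projection.
Context {F : numFieldType} {G : groupType} (p : F -> rat).
Hypotheses (p1 : p 1 = 1) (pD : forall x y, p (x + y) = p x + p y).

Lemma proj0 : p 0 = 0.
Proof. by apply: (addrI (p 0)); rewrite -pD !addr0. Qed.

Lemma projN x : p (- x) = - p x.
Proof. by apply/eqP; rewrite -addr_eq0 -pD addNr proj0. Qed.

(** Boundaries have coefficients [1] and [-1]; hence projecting coefficients is
    compatible with them. *)
Lemma proj_sign i x : p ((-1) ^+ i * x) = (-1) ^+ i * p x.
Proof.
elim: i => [|i IH]; first by rewrite !expr0 !mul1r.
by rewrite !exprS !mulN1r !mulNr projN IH.
Qed.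

Context {P : pred (seq G)} {m : nat}.
Implicit Types (c : chain F P m).

Definition rat_part c : chain rat P m :=
  \sum_(a <- msupp c) p (coef c a) *: mkmalgU a 1.

Lemma coef_proj c b : coef (rat_part c) b = p (coef c b).
Proof.
rewrite -/(coef_at b (rat_part c)) /rat_part linear_sum.
transitivity (\sum_(a <- msupp c) p (coef c a) * (a == b)%:R).
  by apply: eq_bigr => a _; rewrite linearZZ; congr (_ * _); exact: coefU.
have [bc|bc] := boolP (b \in msupp c).
  rewrite (big_fsetD1 b) //= eqxx mulr1 big1_fset ?addr0 // => a.
  by rewrite !inE => /andP[/negPf -> _]; rewrite mulr0.
rewrite [coef c b]mcoeff_outdom // proj0 big_seq big1 // => a ac.
by have [ab|] := eqVneq a b; [rewrite -ab ac in bc | rewrite mulr0].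
Qed.

Lemma projD c c' : rat_part (c + c') = rat_part c + rat_part c'.
Proof.
apply: chainP => b.
by rewrite /coef mcoeffD -!/(coef _ b) !coef_proj -pD /coef mcoeffD.
Qed.

Lemma proj_chain0 : rat_part 0 = 0.
Proof. by apply: chainP => b; rewrite coef_proj /coef !mcoeff0 proj0. Qed.

Lemma projZU z a : rat_part (z *: mkmalgU a 1) = p z *: mkmalgU a 1.
Proof.
apply: chainP => b; rewrite coef_proj /coef !mcoeffZ !mcoeffU.
by case: (a == b); rewrite ?mulr1 ?mulr0n ?mulr0 ?proj0.
Qed.

Lemma projZcls z x : rat_part (z *: cls P x) = p z *: cls P x.
Proof.
have [h|h] := boolP (P x && nondeg x); last first.
  by rewrite !cls_out // !scaler0 proj_chain0.
have /andP[Px nx] := h.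
have [a <- _] := cls_in (k := F) Px nx.
by rewrite !clsU projZU.
Qed.

Lemma proj_cls x : rat_part (cls P x) = cls P x.
Proof. by have := projZcls 1 x; rewrite p1 !scale1r. Qed.

Lemma proj_sum (I : Type) (r : seq I) (f : I -> chain F P m) :
  rat_part (\sum_(i <- r) f i) = \sum_(i <- r) rat_part (f i).
Proof.
by elim: r => [|i r IH]; rewrite ?big_nil ?proj_chain0 // !big_cons projD IH.
Qed.

Lemma proj_signZ i c : rat_part ((-1) ^+ i *: c) = (-1) ^+ i *: rat_part c.
Proof.
by apply: chainP => b; rewrite coef_proj /coef !mcoeffZ proj_sign -!/(coef _ b) coef_proj.
Qed.

End Projection.

Lemma proj_lin_ext {F : numFieldType} {G : groupType} (p : F -> rat)
    (p1 : p 1 = 1) (pD : forall x y, p (x + y) = p x + p y)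
    (P Q : pred (seq G)) m n (f : m.-tuple G -> chain F Q n)
    (f' : m.-tuple G -> chain rat Q n) (c : chain F P m) :
  (forall z x, rat_part p (z *: f x) = p z *: f' x) ->
  rat_part p (lin_ext f c) = lin_ext f' (rat_part p c).
Proof.
move=> h; rewrite [in LHS]/lin_ext proj_sum // [rat_part p c in RHS]/rat_part linear_sum.
apply: eq_bigr => a _; rewrite h linearZZ; congr (_ *: _).
by apply/esym; exact: lin_extU.
Qed.

(** * Words as chains of the Rips complex *)

Section Faces.
Context {G : groupType} {k : comNzRingType}.

Lemma face_word m (i : 'I_m.+1) (t : m.+1.-tuple G) :
  face i t = take i t ++ drop i.+1 t :> seq G.
Proof.
have st := size_tuple t; have im := ltn_ord i.
have sz : size (take i t ++ drop i.+1 t) = m.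
  by rewrite size_cat size_takel ?size_drop st; lia.
apply: (@eq_from_nth _ 1%g); rewrite ?sz ?size_tuple // => j jm.
have -> : nth 1%g (face i t) j = nth 1%g t (bump i j).
  rewrite -[j]/(val (Ordinal jm)) -tnth_nth tnth_mktuple (tnth_nth 1%g) /=.
  by [].
rewrite nth_cat size_takel ?st ?[(i <= _)%N]ltnW // /bump; case: (ltnP j i) => ij.
  by rewrite nth_take // leqNgt ij.
by rewrite nth_drop; congr nth; lia.
Qed.

Lemma delta_tuple (V : lmodType k) (F : seq G -> V) m (t : m.+1.-tuple G) :
  delta F t = \sum_(i < m.+1) (-1) ^+ i *: F (face i t).
Proof.
rewrite (delta_faces (k := k)).
under [RHS]eq_bigr do rewrite face_word.
by rewrite -(big_mkord xpredT (fun i => (-1) ^+ i *: F (take i t ++ drop i.+1 t)))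
  size_tuple big_mkord.
Qed.

Lemma boundary_cls_degenerate (P : pred (seq G)) m (t : m.+1.-tuple G) :
  ~~ nondeg t -> \sum_(i < m.+1) (-1) ^+ i *: cls P (face i t) = 0 :> chain k P m.
Proof.
pose F s : chain k P m := if insub s is Some t' then cls P t' else 0.
have FE (t' : m.-tuple G) : F t' = cls P t' by rewrite /F valK.
have kF : kills_degenerate F.
  move=> s hs; rewrite /F; case: insubP => // t' _ ts.
  by apply: cls_degenerate; rewrite ts.
move=> ht; transitivity (delta F t); last exact: delta_kills.
by rewrite delta_tuple; apply: eq_bigr => i _; rewrite FE.
Qed.

Lemma boundary_cls (P : pred (seq G)) m (t : m.+1.-tuple G) : P t ->
  boundary (cls P t) = \sum_(i < m.+1) (-1) ^+ i *: cls P (face i t)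
  :> chain k P m.
Proof. by move=> Pt; apply: lin_ext_cls => // h; apply: boundary_cls_degenerate. Qed.

End Faces.

HB.instance Definition _ (G : groupType) (k : comNzRingType) (P : pred (seq G))
    (m : nat) (g : G) :=
  GRing.Linear.copy (@act G k P m g) (@act G k P m g).

Section RipsWords.
Context {G : groupType} (S : {fset G}) (r : nat).
Hypotheses (symS : symmetric_subset S) (genS : generating S).

Lemma ripsP (s : seq G) :
  reflect {in s &, forall x y, (word_dist S x y <= r)%N} (rips S r s).
Proof. exact: allrelP. Qed.

Lemma rips_act g s : rips S r s -> rips S r [seq (g * a)%g | a <- s].
Proof.
move=> /ripsP h; apply/ripsP => _ _ /mapP[a ha ->] /mapP[b hb ->].
by rewrite word_dist_mul h.
Qed.

Lemma act_cls {k : comNzRingType} g m (t : m.-tuple G) :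
  act g (cls (rips S r) t)
  = cls (rips S r) [tuple of [seq (g * a)%g | a <- t]] :> chain k _ m.
Proof.
have [Pt|nP] := boolP (rips S r t); last first.
  rewrite !cls_out ?linear0 //.
    rewrite negb_and; apply/orP; left; apply: contra nP.
    move=> /(rips_act g^-1%g); rewrite -map_comp map_id_in // => a _.
    exact: mulKg.
  by rewrite negb_and nP.
apply: lin_ext_cls => // nt; apply: cls_degenerate; apply: contra nt => /=.
rewrite /nondeg sorted_map; apply: sub_sorted => x y /=.
by apply: contra => /eqP ->.
Qed.

End RipsWords.

Section Retraction.
Context {F : numFieldType} {G : groupType} (S : {fset G}) (r : nat).
Hypotheses (symS : symmetric_subset S) (genS : generating S).
Context (eta : forall n, {linear chain F (@bar G) n.+1 ->
                                 chain F (rips S r) n.+1}).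
Hypothesis edr : equivariant_deformation_retraction eta.
Context (p : F -> rat).
Hypotheses (p1 : p 1 = 1) (pD : forall x y, p (x + y) = p x + p y).

(** The retraction onto the Rips complex as a function on words, with rational
    coefficients. In degree [-1], the empty word, it is the identity. *)
Definition retract m : seq G -> chain rat (rips S r) m :=
  match m with
  | 0 => fun s => if s is [::] then cls _ [tuple] else 0
  | n.+1 => fun s => if insub s is Some t then rat_part p (eta n (cls bar t)) else 0
  end.

Lemma retract_tuple n (t : n.+1.-tuple G) :
  retract n.+1 t = rat_part p (eta n (cls bar t)).
Proof. by rewrite /= valK. Qed.

Lemma retract_size m s : size s != m -> retract m s = 0.
Proof.
case: m => [|n] /=; first by case: s.
by case: insubP => // t _ <-; rewrite size_tuple eqxx.
Qed.

Lemma retract_kills m : kills_degenerate (retract m).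
Proof.
case: m => [|n] s hs; first by case: s hs.
rewrite /=; case: insubP => // t _ ts.
by rewrite cls_degenerate ?ts // linear0 proj_chain0.
Qed.

Lemma retract_rips m (t : m.-tuple G) : rips S r t -> retract m t = cls _ t.
Proof.
case: m t => [|n] t Pt; first by rewrite (tuple0 t).
rewrite retract_tuple.
have -> : cls bar t = to_bar (cls (rips S r) t) :> chain F _ _.
  by rewrite /to_bar lin_ext_cls //; apply: cls_degenerate.
by rewrite (edr_retraction edr) proj_cls.
Qed.

Lemma proj_boundary m (c : chain F (rips S r) m.+1) :
  rat_part p (boundary c) = boundary (rat_part p c).
Proof.
apply: proj_lin_ext => // z x; rewrite !scaler_sumr proj_sum //.
apply: eq_bigr => i _.
by rewrite scalerA [z * _]mulrC -scalerA proj_signZ // projZcls // !scalerA mulrC.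
Qed.

Lemma proj_act g m (c : chain F (rips S r) m) :
  rat_part p (act g c) = act g (rat_part p c).
Proof. by apply: proj_lin_ext => // z x; rewrite projZcls. Qed.

(** In degree zero every vertex lies in the Rips complex, where the retraction
    is the identity; in higher degrees it is a chain map. *)
Lemma boundary_retract m s :
  boundary (retract m.+1 s) = delta (retract m) s.
Proof.
have [sm|sm] := eqVneq (size s) m.+1; last first.
  rewrite retract_size // linear0 (delta_faces (k := rat)) big1 // => i _.
  rewrite retract_size ?scaler0 // size_cat size_takel ?size_drop 1?ltnW //.
  by move: (ltn_ord i) sm; lia.
have [t ->] : exists t : m.+1.-tuple G, s = t.
  by exists (tcast sm (in_tuple s)); rewrite val_tcast.
rewrite (delta_tuple (k := rat)); case: m t {s sm} => [|n] t.
  rewrite retract_rips; last first.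
    case/tupleP: t => y t; rewrite tuple0; apply/ripsP => a b.
    by rewrite !inE => /eqP -> /eqP ->; rewrite word_dist0.
  rewrite boundary_cls; first by apply: eq_bigr => i _; rewrite [face i t]tuple0.
  case/tupleP: t => y t; rewrite tuple0; apply/ripsP => a b.
  by rewrite !inE => /eqP -> /eqP ->; rewrite word_dist0.
rewrite retract_tuple -proj_boundary (edr_chain_map edr) boundary_cls //.
rewrite linear_sum proj_sum //; apply: eq_bigr => i _.
by rewrite linearZZ proj_signZ // retract_tuple.
Qed.

Lemma act_retract g m s :
  act g (retract m s) = retract m [seq (g * a)%g | a <- s].
Proof.
case: m => [|n] /=; first by case: s => [|a s] /=; rewrite ?linear0 ?act_cls ?tuple0.
case: insubP => [t _ <-|]; last first.
  case: insubP => [t _ ts|_ _]; last exact: linear0.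
  by rewrite -(size_map (fun a => g * a)%g) -ts size_tuple eqxx.
have -> : [seq (g * a)%g | a <- t] = tval [tuple of [seq (g * a)%g | a <- t]] by [].
rewrite valK -proj_act -(edr_equivariant edr); congr (rat_part p (eta _ _)).
apply: lin_ext_cls => // nt; apply: cls_degenerate; apply: contra nt => /=.
rewrite /nondeg sorted_map; apply: sub_sorted => x y /=.
by apply: contra => /eqP ->.
Qed.

End Retraction.

(** * The contracting homotopy *)

Section Contraction.
Context {F : numFieldType} {G : groupType} (S : {fset G}) (r : nat).
Hypotheses (symS : symmetric_subset S) (genS : generating S).
Context (eta : forall n, {linear chain F (@bar G) n.+1 ->
                                 chain F (rips S r) n.+1}).
Hypothesis edr : equivariant_deformation_retraction eta.
Context (p : F -> rat).
Hypotheses (p1 : p 1 = 1) (pD : forall x y, p (x + y) = p x + p y).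
Context (flow : G -> nat -> G -> chain rat (@bar G) 1).
Hypothesis flow0 : forall x y, flow x 0%N y = cls bar [tuple y].
Hypothesis flow_mass : forall x k y, mass (flow x k y) = 1.
Hypothesis flow_stop : forall x k y, (word_dist S x y <= k)%N ->
  flow x k y = cls bar [tuple x].
Hypothesis flow_act : forall g x k y,
  flow (g * x)%g k (g * y)%g = act g (flow x k y).
Notation retract := (retract eta p).
Notation dist := (word_dist S).

(** A time at which all letters of [s] have reached [x], the speed of the flow
    being at least one. *)
Definition arrival x (s : seq G) : nat := (\sum_(y <- s) dist x y)%N.

(** The homotopy from [s] to its image under the flow at time [N]. *)
Definition sweep x N m (s : seq G) : chain rat (rips S r) m.+1 :=
  \sum_(k < N) prism (flow x k.+1) (flow x k) (retract m.+1) s.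

(** The cone over the constant word at [x] with apex [x]: it is the vertex [x]
    on the empty word, and degenerate on longer ones. *)
Definition apex x m (s : seq G) : chain rat (rips S r) m.+1 :=
  if s is [::] then retract m.+1 [:: x] else 0.

Definition cone x m (s : seq G) : chain rat (rips S r) m.+1 :=
  normalize (sweep x (arrival x s) m) s + apex x m s.

Definition rips_contraction x m : chain rat (rips S r) m -> chain rat (rips S r) m.+1 :=
  lin_ext (fun t => cone x m t).

HB.instance Definition _ x m :=
  GRing.Linear.copy (@rips_contraction x m) (@rips_contraction x m).

Lemma dist_arrival x y s : y \in s -> (dist x y <= arrival x s)%N.
Proof.
by move=> ys; rewrite /arrival (big_rem y ys) leq_addr.
Qed.

Lemma arrival_face x i s : (arrival x (take i s ++ drop i.+1 s) <= arrival x s)%N.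
Proof.
have -> : arrival x s = arrival x (take i s ++ drop i s) by rewrite cat_take_drop.
rewrite /arrival !big_cat leq_add2l; have [si|si] := ltnP i (size s).
  by rewrite (drop_nth 1%g si) big_cons leq_addl.
by rewrite drop_oversize ?big_nil // leqW.
Qed.

Lemma flow_arrived x s k y : (arrival x s <= k)%N -> y \in s ->
  flow x k y = cls bar [tuple x].
Proof. by move=> sk /(dist_arrival x) ys; apply: flow_stop; apply: leq_trans sk. Qed.

(** After the arrival the flow is constant at [x], and the prisms degenerate. *)
Lemma sweep_stable x N m s v : (arrival x s <= N)%N -> {subset v <= s} ->
  sweep x (arrival x s) m v = sweep x N m v.
Proof.
move=> sN vs; rewrite /sweep -(big_mkord xpredT (fun k =>
  prism (flow x k.+1) (flow x k) (retract m.+1) v)) -[RHS](big_mkord xpredT (fun k =>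
  prism (flow x k.+1) (flow x k) (retract m.+1) v)).
rewrite [RHS](big_cat_nat (leq0n _) sN) //= [X in _ + X]big1_seq ?addr0 // => k /andP[_].
rewrite mem_index_iota => /andP[sk _].
apply: (@prism_dirac _ _ _ _ x) => [|y /vs|y /vs]; first exact: retract_kills.
  exact: (flow_arrived (leqW sk)).
exact: (flow_arrived sk).
Qed.

Lemma cone_late x N m s : (arrival x s <= N)%N ->
  cone x m s = normalize (sweep x N m) s + apex x m s.
Proof.
move=> sN; congr (_ + _); apply: eq_normalize_on => v _ vs.
exact: sweep_stable.
Qed.

Lemma cone_kills x m : kills_degenerate (cone x m).
Proof.
move=> s hs; rewrite /cone normalize_degenerate // add0r.
by case: s hs.
Qed.

(** The sum of the prism identities over the steps of the flow telescopes. *)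
Lemma boundary_sweep x N m s : boundary (sweep x N m.+1 s)
  = retract m.+1 s - spread (flow x N) (retract m.+1) s - delta (sweep x N m) s.
Proof.
rewrite /sweep linear_sum delta_sum.
have step k : boundary (prism (flow x k.+1) (flow x k) (retract m.+2) s)
    = (spread (flow x k) (retract m.+1) s - spread (flow x k.+1) (retract m.+1) s)
      - delta (prism (flow x k.+1) (flow x k) (retract m.+1)) s.
  rewrite prism_linear -(@prism_delta _ _ _ _ _ s) ?addrK; last by [].
  by apply: eq_prism => v; exact: boundary_retract.
transitivity (\sum_(k < N) ((spread (flow x k) (retract m.+1) s
    - spread (flow x k.+1) (retract m.+1) s)
    - delta (prism (flow x k.+1) (flow x k) (retract m.+1)) s)).
  by apply: eq_bigr => k _; exact: step.
rewrite sumrB; congr (_ - _).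
rewrite -(@spread_id _ _ (flow x 0%N) (retract m.+1) s) //.
elim: N => [|N IH]; first by rewrite big_ord0 subrr.
by rewrite big_ord_recr IH /= addrA subrK.
Qed.

(** Normalization turns the identity for [sweep] into one on normalized chains,
    and the constant word at [x] left over is the differential of the apex. A
    common number of steps is used for [s] and for its faces. *)
Lemma cone_homotopy x m s : size s = m.+1 ->
  delta (cone x m) s + boundary (cone x m.+1 s) = retract m.+1 s.
Proof.
move=> sm; set N := arrival x s.
have -> : delta (cone x m) s = delta (normalize (sweep x N m)) s + delta (apex x m) s.
  rewrite -deltaD !(delta_faces (k := rat)); apply: eq_bigr => i _.
  congr (_ *: _); apply: cone_late; exact: arrival_face.
rewrite (@cone_late x N) // linearD normalize_additive.
rewrite (_ : apex x m.+1 s = 0); last by case: (s) sm.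
rewrite linear0 addr0 (eq_normalize _ (boundary_sweep x N m)) !normalizeB.
rewrite normalize_delta (normalize_id _ (retract_kills _ _ _)); last exact: pD.
rewrite addrC addrA subrK -[RHS]addr0 -addrA; congr (_ + _).
rewrite (@eq_normalize_on _ _ _ (fun=> retract m.+1 (nseq m.+1 x))); last first.
  move=> v sv vs; rewrite (@spread_dirac _ _ _ x) ?sv ?sm // => y /vs.
  exact: (flow_arrived (leqnn N)).
case: m s sm @N => [|m] [|z [|z' u]] //= _.
  by rewrite subr0 addNr.
rewrite subrr oppr0 add0r (@eq_delta _ _ _ (fun=> 0)) // delta0.
by rewrite /= !subr0.
Qed.

Lemma cone_nil x : cone x 0 [::] = cls (rips S r) [tuple x].
Proof.
rewrite /cone /sweep /arrival big_nil /= big_ord0 add0r.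
apply: (retract_rips edr p1 pD (t := [tuple x])); apply/ripsP => y z.
by rewrite !inE => /eqP -> /eqP ->; rewrite word_dist0.
Qed.

Lemma contraction0 x (c : chain rat (rips S r) 0) :
  boundary (rips_contraction x c) = c.
Proof.
pose f : {linear chain rat (rips S r) 0 -> chain rat (rips S r) 0} :=
  @boundary G rat (rips S r) 0 \o @rips_contraction x 0.
apply: (linear_ext_eq (f := f) (g := idfun)) => a /=.
rewrite /rips_contraction lin_extU (tuple0 (\val a)) /cone /sweep /arrival big_nil.
rewrite /normalize /= big_ord0 add0r boundary_retract //= subr0.
by rewrite -clsU; congr cls; apply/esym/tuple0.
Qed.

Lemma contraction_homotopy x m (c : chain rat (rips S r) m.+1) :
  rips_contraction x (boundary c) + boundary (rips_contraction x c) = c.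
Proof.
pose f : {linear chain rat (rips S r) m.+1 -> chain rat (rips S r) m.+1} :=
  (@rips_contraction x m \o @boundary G rat (rips S r) m)
  \+ (@boundary G rat (rips S r) m.+1 \o @rips_contraction x m.+1).
apply: (linear_ext_eq (f := f) (g := idfun)) => a /=.
have [Pa na] := simplexP a.
rewrite [rips_contraction x (mkmalgU a 1)]lin_extU -clsU boundary_cls //.
rewrite linear_sum -(retract_rips edr p1 pD Pa).
rewrite -(cone_homotopy x (size_tuple (\val a))) (delta_tuple (k := rat)).
congr (_ + _); apply: eq_bigr => i _; rewrite linearZZ; congr (_ *: _).
apply: lin_ext_cls; last exact: cone_kills.
move/ripsP: Pa => Pa; apply/ripsP => y z /mapP[j _ ->] /mapP[j' _ ->].
by apply: Pa; apply: mem_tnth.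
Qed.

Lemma apex_act g x m s :
  act g (apex x m s) = apex (g * x)%g m [seq (g * y)%g | y <- s].
Proof. by case: s => [|y s] /=; [exact: act_retract | exact: linear0]. Qed.

Lemma contraction_act g x m (c : chain rat (rips S r) m) :
  act g (rips_contraction x c) = rips_contraction (g * x)%g (act g c).
Proof.
pose f : {linear chain rat (rips S r) m -> chain rat (rips S r) m.+1} :=
  @act G rat (rips S r) m.+1 g \o @rips_contraction x m.
pose f' : {linear chain rat (rips S r) m -> chain rat (rips S r) m.+1} :=
  @rips_contraction (g * x)%g m \o @act G rat (rips S r) m g.
apply: (linear_ext_eq (f := f) (g := f')) => a /=.
rewrite /rips_contraction act_lin_ext; last exact: rips_act.
rewrite !lin_extU /cone linearD; congr (_ + _); last exact: apex_act.
rewrite normalize_additive normalize_act /arrival big_map.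
under [in RHS]eq_bigr do rewrite word_dist_mul.
apply: eq_normalize => v; rewrite /sweep raddf_sum; apply: eq_bigr => k _.
apply: etrans (prism_linear (@act G rat (rips S r) m.+1 g) _ _ _ _) _.
rewrite (@prism_act _ _ g (flow x k.+1) (flow x k)) //.
by apply: eq_prism => u; exact: act_retract.
Qed.

End Contraction.

(** * Geometry of the flow *)

Section FlowGeometry.
Context {G : groupType} (S : {fset G}).
Hypotheses (symS : symmetric_subset S) (genS : generating S).
Notation dist := (word_dist S).
Context (flow : G -> nat -> G -> chain rat (@bar G) 1) (T A r : nat).

(** The geometric properties of a flow of speed [T]: it moves along geodesics up
    to the constant [A], and these belong to thin triangles. *)
Record tracks_geodesics : Prop := {
  flow_level : forall x k y z, charged (flow x k y) z ->
    dist z y = minn (T * k) (dist x y);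
  flow_near : forall x k y z, charged (flow x k y) z ->
    exists2 v, (dist x v + dist v y = dist x y)%N & (dist z v <= A)%N;
  flow_thin : forall x k y z z', charged (flow x k y) z ->
    (dist z z' + dist y z <= dist y z' + A)%N \/
    (dist z z' + dist x z <= dist x z' + A)%N
}.

Hypothesis track : tracks_geodesics.

Lemma flow_between x k y z : charged (flow x k y) z ->
  (dist x z + dist z y <= dist x y + 2 * A)%N.
Proof.
move=> /(flow_near track)[v xv zv].
have := word_dist_tri genS v x z; have := word_dist_tri genS v z y.
rewrite (word_distC symS genS v z); lia.
Qed.

(** The flows towards nearby points [x] and [x'], started at nearby points, stay
    close at nearby times: they have about the same distances to [x] and to [y],
    hence are close by thinness of triangles. *)
Lemma flow_diam e x x' k k' y y' z z' :
  charged (flow x k y) z -> charged (flow x' k' y') z' ->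
  (dist x x' <= e)%N -> (dist y y' <= r)%N -> (k <= k'.+1)%N -> (k' <= k.+1)%N ->
  (dist z z' <= 3 * A + 3 * e + 2 * r + T)%N.
Proof.
move=> cz cz' xx yy kk kk'.
have lz := flow_level track cz; have lz' := flow_level track cz'.
have bz := flow_between cz; have bz' := flow_between cz'.
have kT : (T * k <= T * k' + T)%N by rewrite addnC -mulnS leq_mul2l kk orbT.
have kT' : (T * k' <= T * k + T)%N by rewrite addnC -mulnS leq_mul2l kk' orbT.
have t1 := word_dist_tri genS x' x y; have t2 := word_dist_tri genS y' x' y.
have t3 := word_dist_tri genS x x' y'; have t4 := word_dist_tri genS y x y'.
have t5 := word_dist_tri genS y' y z'; have t6 := word_dist_tri genS x' x z'.
have t7 := word_dist_tri genS z x y.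
have c1 := word_distC symS genS x x'; have c2 := word_distC symS genS y y'.
have c3 := word_distC symS genS y z; have c4 := word_distC symS genS y' z'.
by case: (flow_thin track z' cz) => h; lia.
Qed.

(** Only a bounded number of steps of the flow pass near a given point [q],
    because [T * k] is then about the distance of [q] to the starting point. The
    last hypothesis excludes the steps long after the arrival. *)
Lemma flow_time e M x k k' y y' y1 z q :
  charged (flow x k' y) z -> (k <= k' <= k.+1)%N -> (dist q z <= M)%N ->
  (dist y y' <= r)%N -> (dist y y1 <= r)%N ->
  (T * k <= dist x y' + e)%N ->
  (T * k <= dist q y1 + (e + 2 * r + T + M))%N /\
  (dist q y1 <= T * k + (e + 2 * r + T + M))%N.
Proof.
move=> cz /andP[kk kk'] qz yy yy1 rel; have lz := flow_level track cz.
have kT : (T * k <= T * k')%N by rewrite leq_mul2l kk orbT.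
have kT' : (T * k' <= T * k + T)%N by rewrite addnC -mulnS leq_mul2l kk' orbT.
have t1 := word_dist_tri genS y x y'; have t2 := word_dist_tri genS z q y1.
have t3 := word_dist_tri genS y z y1; have t4 := word_dist_tri genS q z y.
have t5 := word_dist_tri genS y1 q y.
have c1 := word_distC symS genS q z; have c2 := word_distC symS genS y1 y.
lia.
Qed.

(** The distance of [x] to a point of the flow from [y] at time [k] is about
    [dist x y - T * k]. As it bounds the Gromov product of [x] and [x'] based at
    this point, the latter is at most the Gromov product based at [y],
    diminished by [T * k] and up to a constant. *)
Lemma flow_gromov e M x0 x1 x x' k k' j y0 y y' z q :
  charged (flow x0 k' y0) z -> (k <= k')%N -> (j <= k.+1)%N ->
  (x0 = x \/ x0 = x') -> (x1 = x \/ x1 = x') ->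
  (dist q z <= M)%N -> (dist x x' <= e)%N ->
  (dist y y0 <= r)%N -> (dist y' y <= r)%N -> (T * k <= dist x1 y')%N ->
  (dist x q + dist x' q + 2 * (T * j)
   <= dist x y + dist x' y + 2 * (2 * A + M + 2 * e + r + T))%N.
Proof.
move=> cz kk jk x0E x1E qz xx yy0 yy' rel.
have lz := flow_level track cz; have bz := flow_between cz.
have kT : (T * k <= T * k')%N by rewrite leq_mul2l kk orbT.
have jT : (T * j <= T * k + T)%N by rewrite addnC -mulnS leq_mul2l jk orbT.
have a1 := word_dist_tri genS z x0 q; have a2 := word_dist_tri genS y' x1 y.
have a3 := word_dist_tri genS y x1 y'; have a4 := word_dist_tri genS y x0 y0.
have c1 := word_distC symS genS x x'; have c2 := word_distC symS genS y' y.
have c3 := word_distC symS genS z q; have c4 := word_distC symS genS y y0.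
have b1 := word_dist_tri genS x x' q; have b2 := word_dist_tri genS x' x q.
have b3 := word_dist_tri genS x x' y; have b4 := word_dist_tri genS x' x y.
by case: x0E x1E => ? [] ?; subst x0 x1; lia.
Qed.

End FlowGeometry.

(** * Uniform bounds for the retraction *)

(** Translation permutes the nondegenerate simplices. *)
Lemma coef_act {G : groupType} {k : comNzRingType} (S : {fset G}) r g m
    (b : simplex (rips S r) m) :
  exists b' : simplex (rips S r) m,
    (forall v, v \in val b -> (g^-1 * v)%g \in val b') /\
    forall c : chain k (rips S r) m, coef (act g c) b = coef c b'.
Proof.
have [Pb nb] := simplexP b.
have [||b' b'E _] := @cls_in _ k (rips S r) m [tuple of [seq (g^-1 * v)%g | v <- val b]].
- exact: rips_act.
- rewrite /nondeg sorted_map; apply: sub_sorted nb => x y /=.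
  by apply: contra => /eqP/mulgI ->.
exists b'; split=> [v vb|c].
  by rewrite b'E; apply/mapP; exists v.
pose f : {linear chain k (rips S r) m -> k^o} := coef_at b \o @act G k (rips S r) m g.
apply: (linear_ext_eq (f := f) (g := coef_at b')) => a /=.
rewrite /coef_at -clsU act_cls.
have [Pa na] := simplexP a.
have [||a' a'E ->] := @cls_in _ k (rips S r) m [tuple of [seq (g * v)%g | v <- val a]].
- exact: rips_act.
- rewrite /nondeg sorted_map; apply: sub_sorted na => x y /=.
  by apply: contra => /eqP/mulgI ->.
rewrite clsU !coefU; congr (_ : bool)%:R; apply/eqP/eqP => e.
  apply/val_inj/val_inj; rewrite b'E -e a'E /= -map_comp map_id_in // => v _ /=.
  by rewrite mulKg.
apply/val_inj/val_inj; rewrite a'E e b'E /= -map_comp map_id_in // => v _ /=.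
by rewrite mulVKg.
Qed.

Lemma finite_bound (I : eqType) (l : seq I) (P : nat -> I -> Prop) :
  (forall m m' i, (m <= m')%N -> P m i -> P m' i) -> (forall i, exists m, P m i) ->
  exists m, forall i, i \in l -> P m i.
Proof.
move=> mono /choice[f hf]; exists (\max_(i <- l) f i)%N => i il.
by apply: mono (hf i); apply: (@leq_bigmax_seq _ _ _ f).
Qed.

Section RetractBounds.
Context {F : numFieldType} {G : groupType} (S : {fset G}) (r : nat).
Hypotheses (symS : symmetric_subset S) (genS : generating S).
Context (eta : forall n, {linear chain F (@bar G) n.+1 ->
                                 chain F (rips S r) n.+1}).
Hypothesis edr : equivariant_deformation_retraction eta.
Context (p : F -> rat).
Hypotheses (p1 : p 1 = 1) (pD : forall x y, p (x + y) = p x + p y).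
Notation retract := (retract eta p).
Notation dist := (word_dist S).

Definition bounded_by m M (s : seq G) := forall b,
  `|coef (retract m s) b| <= M%:R /\
  (coef (retract m s) b != 0 -> forall v z, v \in val b -> z \in s -> (dist v z <= M)%N).

(** By equivariance it suffices to bound finitely many values, each of which is
    a chain with finite support. *)
Lemma retract_bounded m n D : exists M, forall x s, size s = n ->
  (forall y, y \in s -> (dist x y <= D)%N) -> bounded_by m M s.
Proof.
apply: bounded_words_bound => // [M M' s MM h b|g M s h b|s].
- have [h1 h2] := h b; split; first by apply: le_trans h1 _; rewrite ler_nat.
  by move=> /h2 h3 v z vb zs; apply: leq_trans MM; apply: h3.
- have [b' [hb' e]] := coef_act (k := rat) g b.
  rewrite -act_retract // e; have [h1 h2] := h b'; split=> // /h2 h3 v _ vb /mapP[z zs ->].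
  by rewrite -(mulVKg g v) word_dist_mul; apply: h3 => //; apply: hb'.
pose P M (b : simplex (rips S r) m) := `|coef (retract m s) b| <= M%:R /\
  forall v z, v \in val b -> z \in s -> (dist v z <= M)%N.
have [||M hM] := @finite_bound _ (msupp (retract m s)) P.
- move=> M M' b MM [h1 h2]; split; first by apply: le_trans h1 _; rewrite ler_nat.
  by move=> v z vb zs; apply: leq_trans MM; apply: h2.
- move=> b; exists (maxn (Num.bound `|coef (retract m s) b|)
    (\max_(v <- val b) \max_(z <- s) dist v z)); split.
    apply: (le_trans (ltW (archi_boundP (normr_ge0 _)))).
    by rewrite ler_nat leq_maxl.
  move=> v z vb zs; rewrite leq_max; apply/orP; right.
  apply: leq_trans (@leq_bigmax_seq _ _ _ (fun v => \max_(z <- s) dist v z)%N v vb isT).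
  exact: (@leq_bigmax_seq _ _ _ (fun z => dist v z) z zs isT).
exists M => b; have [cb|cb] := eqVneq (coef (retract m s) b) 0.
  by rewrite cb normr0 ler0n.
have bs : b \in msupp (retract m s) by rewrite -mcoeff_neq0.
by have [h1 h2] := hM _ bs.
Qed.

End RetractBounds.

(** * Sums over the steps of the flow *)

Lemma count_window a n N : (count (fun k => a <= k < a + n)%N (iota 0 N) <= n)%N.
Proof.
rewrite -size_filter -[leqRHS](size_iota a n); apply: uniq_leq_size.
  by rewrite filter_uniq // iota_uniq.
by move=> k; rewrite mem_filter => /andP[kn _]; rewrite mem_iota.
Qed.

(** At most [2 W + 2] multiples of [T] lie within distance [W] of [c]. *)
Lemma sum_window (R : numDomainType) (f : nat -> R) N T W c (B : R) : (0 < T)%N ->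
  (forall k, f k != 0 -> (T * k <= c + W)%N /\ (c <= T * k + W)%N) ->
  (forall k, `|f k| <= B) -> `|\sum_(k < N) f k| <= (2 * W + 2)%:R * B.
Proof.
move=> T0 hf hB; have B0 : 0 <= B by apply: le_trans (hB 0%N).
pose a := ((c - W) %/ T)%N.
have win k : f k != 0 -> (a <= k < a + (2 * W + 2))%N.
  move=> /hf[h1 h2]; apply/andP; split.
    by rewrite /a -(leq_pmul2l T0) mulnC; apply: leq_trans (leq_trunc_div _ _) _; lia.
  have := ltn_ceil (c - W) T0; rewrite -/a => h3.
  have : (k < a.+1 + (2 * W).+1)%N by nia.
  by lia.
rewrite -(big_mkord xpredT f); apply: le_trans (ler_norm_sum _ _ _) _.
apply: (@le_trans _ _ (\sum_(0 <= k < N | (a <= k < a + (2 * W + 2))%N) B)).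
  rewrite [leRHS]big_mkcond; apply: ler_sum => k _.
  case: ifP => // /negbT h; rewrite (_ : f k = 0) ?normr0 //.
  by apply/eqP; apply: contraNT h; apply: win.
rewrite big_const_seq iter_addr_0 -[leLHS]mulr_natl ler_wpM2r // ler_nat.
rewrite /index_iota subn0; exact: count_window.
Qed.

(** * Estimates for the contracting homotopy *)

Section ContractionEstimates.
Context {F : numFieldType} {G : groupType} (S : {fset G}) (r : nat).
Hypotheses (symS : symmetric_subset S) (genS : generating S).
Context (eta : forall n, {linear chain F (@bar G) n.+1 ->
                                 chain F (rips S r) n.+1}).
Hypothesis edr : equivariant_deformation_retraction eta.
Context (p : F -> rat).
Hypotheses (p1 : p 1 = 1) (pD : forall x y, p (x + y) = p x + p y).
Context (flow : G -> nat -> G -> chain rat (@bar G) 1) (T A : nat).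
Hypothesis T0 : (0 < T)%N.
Hypothesis flow_prob : forall x k y, is_prob (flow x k y).
Hypothesis flow_stop : forall x k y, (word_dist S x y <= T * k)%N ->
  flow x k y = cls bar [tuple x].
Hypothesis track : tracks_geodesics S flow T A.
Notation retract := (retract eta p).
Notation dist := (word_dist S).
Notation cone := (cone eta p flow).
Notation sweep := (sweep eta p flow).

Context (m e M : nat).
Hypothesis hM : forall x s, size s = m.+1 ->
  (forall y, y \in s -> (dist x y <= 3 * A + 3 * e + 2 * r + T)%N) ->
  bounded_by eta p m.+1 M s.

Context (x x' : G) (s : seq G) (b : simplex (rips S r) m.+1).
Hypotheses (xx' : (dist x x' <= e)%N) (Rs : rips S r s) (sm : size s = m).

(** The letters occurring in the [k]-th prism of the flows towards [x] and
    [x']. *)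
Definition passed k z : Prop := exists x0 k0 y,
  [/\ x0 = x \/ x0 = x', (k <= k0 <= k.+1)%N, y \in s & charged (flow x0 k0 y) z].

Definition active k : Prop :=
  exists2 z, passed k z & forall q, q \in val b -> (dist q z <= M)%N.

Definition arrived k : Prop := forall x0 y, x0 = x \/ x0 = x' -> y \in s ->
  (dist x0 y <= T * k)%N.

(** The steps that contribute to the coefficient at [b] of the homotopies
    towards [x] and [x']: the retraction of a simplex is supported near this
    simplex, and prisms degenerate once the flow has arrived. *)
Definition relevant k : Prop := active k /\ ~ arrived k.

Notation Fb := (fun v => coef (retract m.+1 v) b : rat^o).

Lemma passed_carried k x0 k0 v : x0 = x \/ x0 = x' -> (k <= k0 <= k.+1)%N ->
  {subset v <= s} -> carried (passed k) v (flow x0 k0).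
Proof. by move=> hx hk vs y /vs ys; split=> // z cz; exists x0, k0, y. Qed.

Lemma passed_diam k z z' : passed k z -> passed k z' ->
  (dist z z' <= 3 * A + 3 * e + 2 * r + T)%N.
Proof.
case=> x0 [k0 [y [hx /andP[kk kk'] ys cz]]].
case=> x1 [k1 [y' [hx' /andP[kk1 kk1'] ys' cz']]].
apply: (flow_diam symS genS track cz cz'); try lia.
  case: hx hx' => -> [] -> //; rewrite ?word_dist0 //.
  by rewrite word_distC.
by move/ripsP: Rs; apply.
Qed.

Lemma retract_on_passed k : bounded_on (passed k) m.+1 Fb M%:R.
Proof.
move=> [|z v] // vm hv; have [|h _] := hM (x := z) vm _ b; last exact: h.
by move=> y yv; apply: passed_diam; apply: hv => //; apply: mem_head.
Qed.

Lemma retract_inactive k : ~ active k -> bounded_on (passed k) m.+1 Fb 0.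
Proof.
move=> na [|z v] // vm hv; rewrite normr_le0; apply: contrapT => /negP nz; apply: na.
exists z; first by apply: hv; apply: mem_head.
have [|_ h] := hM (x := z) vm _ b.
  by move=> y yv; apply: passed_diam; apply: hv => //; apply: mem_head.
by move=> q qb; apply: h => //; apply: mem_head.
Qed.

Definition term x0 k v : rat := prism (flow x0 k.+1) (flow x0 k) Fb v.

Lemma term_bound x0 k v : x0 = x \/ x0 = x' -> size v = m -> {subset v <= s} ->
  `|term x0 k v| <= m%:R * M%:R.
Proof.
move=> hx vm vs; rewrite -vm; apply: (@prism_bound _ (passed k)).
- by apply: passed_carried => //; rewrite leqnSn leqnn.
- by apply: passed_carried => //; rewrite leqnSn leqnn.
- rewrite vm; exact: retract_on_passed.
Qed.

Lemma term_relevant x0 k v : x0 = x \/ x0 = x' -> size v = m -> {subset v <= s} ->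
  term x0 k v != 0 -> relevant k.
Proof.
move=> hx vm vs nz; split; apply: contrapT.
  move=> na; move: nz; rewrite -normr_le0; apply/negP/negPn.
  rewrite -[X in _ <= X](mulr0 (size v)%:R); apply: (@prism_bound _ (passed k)).
  - by apply: passed_carried => //; rewrite leqnSn leqnn.
  - by apply: passed_carried => //; rewrite leqnSn leqnn.
  - rewrite vm; exact: retract_inactive.
move=> /contrapT ar; move: nz; rewrite /term (@prism_dirac _ _ _ _ x0) ?eqxx //.
- by move=> u hu; rewrite /coef retract_kills // mcoeff0.
- move=> y /vs ys; apply: flow_stop; apply: leq_trans (ar _ _ hx ys) _.
  by rewrite leq_mul2l leqnSn orbT.
- by move=> y /vs ys; apply: flow_stop; apply: ar.
Qed.

Lemma term_close k v (d : rat) : size v = m -> {subset v <= s} ->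
  (forall j y, (k <= j <= k.+1)%N -> y \in s ->
     norm1 (flow x j y - flow x' j y) <= d) ->
  `|term x k v - term x' k v| <= (m * m.+1)%:R * (d * M%:R).
Proof.
move=> vm vs hd; rewrite -vm.
apply: (@prism_close _ (passed k)) => //; try (by move=> y /vs ys; apply: hd;
  rewrite ?leqnSn ?leqnn); try (by apply: passed_carried; rewrite ?leqnSn ?leqnn; auto).
rewrite vm; exact: retract_on_passed.
Qed.

Lemma not_arrived k : ~ arrived k -> exists x0 y,
  [/\ x0 = x \/ x0 = x', y \in s & (T * k <= dist x0 y)%N].
Proof.
move=> na; apply: contrapT => h; apply: na => x0 y hx ys.
by rewrite leqNgt; apply/negP => lt; apply: h; exists x0, y; split=> //; apply: ltnW.
Qed.

Lemma dist_either x0 x1 y : x0 = x \/ x0 = x' -> x1 = x \/ x1 = x' ->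
  (dist x0 y <= dist x1 y + e)%N.
Proof.
have t1 := word_dist_tri genS x' x y; have t2 := word_dist_tri genS x x' y.
have c := word_distC symS genS x x'.
by case=> -> [] ->; lia.
Qed.

Lemma relevant_time k : relevant k ->
  (T * k <= dist (thead (val b)) (head 1%g s) + (e + 2 * r + T + M))%N /\
  (dist (thead (val b)) (head 1%g s) <= T * k + (e + 2 * r + T + M))%N.
Proof.
case=> [[z [x0 [k0 [y [hx hk ys cz]]]] hz] /not_arrived[x1 [y' [hx1 ys' lt]]]].
have hs : head 1%g s \in s by case: (s) ys => // a u _; apply: mem_head.
apply: (flow_time symS genS track cz hk _ (y' := y')).
- by apply: hz; apply: mem_tnth.
- by move/ripsP: Rs; apply.
- by move/ripsP: Rs; apply.
- exact: leq_trans lt (dist_either _ hx1 hx).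
Qed.

Lemma relevant_gromov k j y : relevant k -> (j <= k.+1)%N -> y \in s ->
  let q := thead (val b) in
  (dist x q + dist x' q + 2 * (T * j)
   <= dist x y + dist x' y + 2 * (2 * A + M + 2 * e + r + T))%N.
Proof.
case=> [[z [x0 [k0 [y0 [hx /andP[hk _] ys0 cz]]]] hz] /not_arrived[x1 [y' [hx1 ys' lt]]]].
move=> jk ys; rewrite /=.
apply: (flow_gromov symS genS track cz hk jk hx hx1 (y' := y')) => //.
- by apply: hz; apply: mem_tnth.
- by move/ripsP: Rs; apply.
- by move/ripsP: Rs; apply.
Qed.

Lemma coef_sweep x0 N v : coef (sweep x0 N m v) b = \sum_(k < N) term x0 k v.
Proof.
transitivity (coef_at b (sweep x0 N m v)); first by [].
rewrite /sweep linear_sum; apply: eq_bigr => k _.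
exact: (prism_linear (coef_at b)).
Qed.

Lemma coef_cone x0 N : (0 < m)%N -> (arrival S x0 s <= N)%N ->
  coef (cone x0 m s) b = normalize (fun v => \sum_(k < N) term x0 k v) s.
Proof.
move=> m0 sN.
have stop1 x1 k y : (dist x1 y <= k)%N -> flow x1 k y = cls bar [tuple x1].
  by move=> h; apply: flow_stop; apply: leq_trans h _; rewrite leq_pmull.
rewrite (@cone_late _ _ _ _ _ _ pD _ stop1 _ N) //.
rewrite (_ : apex _ _ _ _ _ = 0); last by case: (s) sm m0 => // <-.
rewrite addr0 -[LHS]/(coef_at b _) (normalize_additive (coef_at b)).
by apply: eq_normalize => v; apply: coef_sweep.
Qed.

(** Normalization replaces [s] by [2 ^ m] words at most, and for each of them
    boundedly many prisms contribute to the coefficient at [b]. *)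
Lemma coef_cone_bound : (0 < m)%N ->
  `|coef (cone x m s) b| <=
    2 ^+ m * ((2 * (e + 2 * r + T + M) + 2)%:R * (m%:R * M%:R)).
Proof.
move=> m0; rewrite (coef_cone m0 (leqnn _)) -{1}sm.
apply: normalize_bound => v vs vss; rewrite sm in vs.
apply: (@sum_window _ (fun k => term x k v) _ T (e + 2 * r + T + M)
  (dist (thead (val b)) (head 1%g s)) _ T0) => k.
  by move=> /(term_relevant _ vs vss) h; apply: relevant_time; apply: h; left.
by apply: term_bound => //; left.
Qed.

Lemma coef_cone_active : (0 < m)%N -> coef (cone x m s) b != 0 -> exists k, active k.
Proof.
move=> m0; rewrite (coef_cone m0 (leqnn _)) => nz; apply: contrapT => na.
move: nz; rewrite (@eq_normalize_on _ _ _ (fun=> 0)).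
  suff -> : normalize (fun=> 0 : rat) s = 0 by rewrite eqxx.
  apply/eqP; rewrite -normr_le0 -[X in _ <= X](mulr0 (2 ^+ size s)).
  by apply: normalize_bound => v _ _; rewrite normr0.
move=> v vs vss; rewrite sm in vs; apply: big1 => k _; apply: contrapT => /eqP h.
by have [hk _] := term_relevant (or_introl erefl) vs vss h; apply: na; exists k.
Qed.

(** The homotopies towards [x] and [x'] consist of the same prisms of different
    measures, and only the relevant steps contribute to the coefficient at
    [b]. *)
Lemma coef_cone_close (K : realFieldType) (E : K) : (0 < m)%N -> 0 <= E ->
  (forall k j y, relevant k -> (j <= k.+1)%N -> y \in s ->
     ratr (norm1 (flow x j y - flow x' j y)) <= E) ->
  `|ratr (coef (cone x m s) b - coef (cone x' m s) b)| <=
    2 ^+ m * ((2 * (e + 2 * r + T + M) + 2)%:R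
              * ((m * m.+1)%:R * ((2 * m)%:R * E * M%:R))).
Proof.
move=> m0 E0 hE; pose N := maxn (arrival S x s) (arrival S x' s).
rewrite (coef_cone (N := N)) ?leq_maxl // (coef_cone (N := N)) ?leq_maxr //.
rewrite -normalizeB (normalize_additive (@ratr K)) -{1}sm.
apply: normalize_bound => v vs vss; rewrite sm in vs; rewrite -sumrB raddf_sum.
set B := (X in _ <= X).
apply: (@sum_window _ (fun k => ratr (term x k v - term x' k v)) _ T
  (e + 2 * r + T + M) (dist (thead (val b)) (head 1%g s)) _ T0) => k.
  rewrite fmorph_eq0 => nz; apply: relevant_time.
  have [tx|tx] := eqVneq (term x k v) 0; last first.
    by apply: (term_relevant _ vs vss tx); left.
  apply: (@term_relevant x' k v _ vs vss); first by right.
  by move: nz; rewrite tx sub0r oppr_eq0.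
have [rk|nrk] := pselect (relevant k); last first.
  rewrite (_ : term x k v - term x' k v = 0) ?rmorph0 ?normr0 ?mulr_ge0 //.
  have z x0 : x0 = x \/ x0 = x' -> term x0 k v = 0.
    by move=> hx; apply: contrapT => /eqP h; apply/nrk/(term_relevant hx vs vss h).
  by rewrite !z ?subrr //; [right | left].
pose n j y := norm1 (flow x j y - flow x' j y).
(* The bound by [E] is real; a rational bound for the distances of the measures
   is needed in order to estimate the prisms. *)
pose d := \sum_(y <- s) (n k y + n k.+1 y).
have n0 j y : 0 <= n j y by apply: norm1_ge0.
have hd : ratr d <= (2 * m)%:R * E.
  rewrite rmorph_sum -sm natrM -mulrA mulrCA mulr_natl.
  apply: (@le_trans _ _ (\sum_(y <- s) (2 * E))).
    rewrite big_seq [leRHS]big_seq; apply: ler_sum => y ys.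
    by rewrite rmorphD /= mulr2n mulrDl mul1r lerD //; apply: (hE k).
  by rewrite big_const_seq count_predT iter_addr_0.
apply: (@le_trans _ _ (ratr ((m * m.+1)%:R * (d * M%:R)))).
  rewrite -ratr_norm ler_rat; apply: term_close => // j y hj ys.
  have : n j y <= n k y + n k.+1 y.
    have [->|->] : j = k \/ j = k.+1 by lia.
      by rewrite lerDl.
    by rewrite lerDr.
  move=> h; apply: (le_trans h); rewrite /d (big_rem y ys) /= lerDl.
  by apply: sumr_ge0 => i _; rewrite addr_ge0.
rewrite !rmorphM /= !ratr_nat; apply: ler_wpM2l; first by rewrite mulr_ge0.
exact: (ler_wpM2r (ler0n _ _) hd).
Qed.

End ContractionEstimates.

(** * The flow along Mineyev's maps *)

Section MineyevFlow.
Context {K : realType} {G : groupType} (S : {fset G}).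
Hypotheses (symS : symmetric_subset S) (genS : generating S).
Notation dist := (word_dist S).
Context (delta : nat) (w : G -> seq G) (C1 lambda1 : K).
Context (phi : nat -> G -> G -> chain rat (@bar G) 1).
Hypotheses (hyp : hyperbolic (cayley_dist : cayley_point K S -> cayley_point K S -> K)
    delta%:R) (wG : geodesic_words S w) (mm : mineyev_maps S delta w C1 lambda1 phi).

Definition flow x k y : chain rat (@bar G) 1 :=
  if k is 0 then cls bar [tuple y] else phi k x y.

Lemma flow_prob x k y : is_prob (flow x k y).
Proof.
case: k => [|k]; first exact: is_prob_dirac.
by split=> [a|]; [apply: (mm_ge0 mm) | apply: (mm_sum mm)].
Qed.

Lemma flow_stop x k y : (dist x y <= 10 * delta * k)%N ->
  flow x k y = cls bar [tuple x].
Proof.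
case: k => [|k] h; last by apply: (mm_near mm) => //; lia.
by rewrite /= (@word_dist_eq0 _ _ genS x y) //; lia.
Qed.

Lemma flow_act g x k y : flow (g * x)%g k (g * y)%g = act g (flow x k y).
Proof.
case: k => [|k] /=; last exact: (mm_equivariant mm).
apply/esym; apply: etrans (lin_ext_cls (P := bar) _ _) _ => //.
by congr cls; apply: val_inj.
Qed.

(** At time [k] there are three cases: the flow has not started, has arrived, or
    is on its way near the chosen geodesic. *)
Lemma flow_tracks : tracks_geodesics S flow (10 * delta) (4 * (delta + 3)).
Proof.
have dirac x k y z : charged (flow x k y) z ->
  [\/ k = 0%N /\ z = y,
      z = x /\ (dist x y <= 10 * delta * k)%N |
      dist z y = (10 * delta * k)%N /\ (10 * delta * k < dist x y)%N /\
      nbhd_of cayley_dist (chosen_geodesic w x y : set (cayley_point K S))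
        delta%:R (Vertex z)].
  have [xy|xy] := leqP (dist x y) (10 * delta * k).
    by rewrite flow_stop // => /charged_dirac ->; constructor 2.
  case: k xy => [|k] xy; first by move=> /charged_dirac ->; constructor 1.
  have xy' : (10 * k.+1 * delta < dist x y)%N by lia.
  move=> [a ca <-]; have [||ng ->] := mm_supp mm (z := thead (val a)) _ xy' ca => //.
    exact: mem_tnth.
  by constructor 3; split=> //; lia.
have thin := near_geodesic_thin symS genS wG hyp.
split=> [x k y z|x k y z|x k y z z'] /dirac.
- by case=> [[-> ->]|[-> h]|[-> [h _]]]; rewrite ?word_dist0; lia.
- case=> [[_ ->]|[-> _]|[_ [_ /thin[[v [xv zv]] _]]]]; last by exists v.
    by exists y; rewrite word_dist0 ?addn0.
  by exists x; rewrite word_dist0 ?add0n.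
- case=> [[_ ->]|[-> _]|[_ [_ /thin[_ h]]]]; last exact: h.
    by left; rewrite word_dist0; lia.
  by right; rewrite word_dist0; lia.
Qed.

Lemma flow_decay x x' k y : 0 < C1 ->
  ratr (norm1 (flow x k y - flow x' k y)) <=
  C1 * lambda1 `^ (gromov (word_metric K S) x x' y - (10 * delta * k)%:R).
Proof.
move=> C0; case: k => [|k].
  by rewrite subrr norm1_0 rmorph0 mulr_ge0 ?powR_ge0 // ltW.
by have := mm_decay mm x x' y (ltn0Sn k); rewrite mulnAC.
Qed.

End MineyevFlow.

(** * Monotone majorants *)

Section Majorants.
Context {R : numDomainType}.

Definition psum (f : nat -> R) n : R := \sum_(i < n.+1) f i.

Lemma psum_ge0 f n : (forall i, 0 <= f i) -> 0 <= psum f n.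
Proof. by move=> f0; apply: sumr_ge0. Qed.

Lemma psum_mono f g n n' : (forall i, 0 <= g i) -> (forall i, f i <= g i) ->
  (n <= n')%N -> psum f n <= psum g n'.
Proof.
move=> g0 fg nn; apply: (@le_trans _ _ (psum g n)); first exact: ler_sum.
rewrite /psum -!(big_mkord xpredT g) (big_cat_nat (n := n.+1) (p := n'.+1)) //=.
by rewrite lerDl; apply: sumr_ge0.
Qed.

Lemma le_psum f n : (forall i, 0 <= f i) -> f n <= psum f n.
Proof. by move=> f0; rewrite /psum big_ord_recr /= lerDr; apply: sumr_ge0. Qed.

(** Replaces any family of constants by larger ones that are monotone in the
    parameters. *)
Definition majorant (c : nat -> nat -> nat -> R) i j l : R :=
  psum (fun i => psum (fun j => psum (c i j) l) j) i.

Lemma majorant_mono c i i' j j' l l' : (forall i j l, 0 <= c i j l) ->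
  (i <= i')%N -> (j <= j')%N -> (l <= l')%N ->
  majorant c i j l <= majorant c i' j' l'.
Proof.
move=> c0 ii jj ll; apply: psum_mono => // a.
  by apply: psum_ge0 => b; apply: psum_ge0.
by apply: psum_mono => // b; [apply: psum_ge0 | apply: psum_mono].
Qed.

Lemma le_majorant c i j l : (forall i j l, 0 <= c i j l) ->
  c i j l <= majorant c i j l.
Proof.
move=> c0; apply: le_trans (le_psum (f := c i j) l _) _ => //.
apply: le_trans (le_psum (f := fun j => psum (c i j) l) j _) _.
  by move=> b; apply: psum_ge0.
apply: (le_psum (f := fun i => psum (fun j => psum (c i j) l) j)).
by move=> a; apply: psum_ge0 => b; apply: psum_ge0.
Qed.

End Majorants.

(** * The homotopy in degree minus one *)

Section DegreeMinusOne.
Context {K : realType} {F : numFieldType} {G : groupType} (S : {fset G}) (r : nat).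
Hypotheses (symS : symmetric_subset S) (genS : generating S).
Context (eta : forall n, {linear chain F (@bar G) n.+1 ->
                                 chain F (rips S r) n.+1}).
Hypothesis edr : equivariant_deformation_retraction eta.
Context (p : F -> rat).
Hypotheses (p1 : p 1 = 1) (pD : forall x y, p (x + y) = p x + p y).
Context (flow : G -> nat -> G -> chain rat (@bar G) 1).
Notation cone := (cone eta p flow).

Lemma coef_cone_nil x (b : simplex (rips S r) 1) :
  coef (cone x 0 [::]) b = (val b == [tuple x])%:R.
Proof.
rewrite (cone_nil edr p1 pD) /cls; case: insubP => [a _ ax|].
  rewrite coefU -ax; congr (_ : bool)%:R.
  by apply/eqP/eqP => [->//|h]; apply/val_inj.
move=> /negP nx; case: eqP => [bx|_]; last by rewrite /coef mcoeff0.
by case: nx; have [] := simplexP b; rewrite bx => -> ->.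
Qed.

(** The two homotopies differ only at [x] and [x'], where the Gromov product
    vanishes. *)
Lemma coef_cone_nil_close x x' (b : simplex (rips S r) 1) (l : K) : 0 < l < 1 ->
  `|ratr (coef (cone x 0 [::]) b - coef (cone x' 0 [::]) b)|
  <= l `^ (gromov_min K x x' b).
Proof.
move=> /andP[l0 l1]; rewrite !coef_cone_nil.
have small : val b = [tuple x] \/ val b = [tuple x'] -> 1 <= l `^ (gromov_min K x x' b).
  move=> bx; rewrite -(powRr0 l); apply: ger_powR; first by rewrite l0 ltW.
  apply: le_trans (bigmin_le_id _ _ _ _) _; rewrite /gromov.
  by case: bx => ->; rewrite theadE /word_metric word_dist0 ?(word_distC symS genS x' x);
    lra.
case: eqP => bx; case: eqP => bx'; rewrite ?subrr ?rmorph0 ?normr0 ?powR_ge0 //.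
  by rewrite subr0 rmorph1 normr1; apply: small; left.
by rewrite sub0r rmorphN rmorph1 normrN1; apply: small; right.
Qed.

End DegreeMinusOne.

(** * The contraction of the Rips complex *)

Theorem theorem2p19 (K : realType) (G : groupType) (S : {fset G}) (r : nat)
    (eta : forall n, {linear chain K[i] (@bar G) n.+1 ->
                             chain K[i] (rips S r) n.+1}) :
  symmetric_subset S -> generating S -> ~~ odd r ->
  equivariant_deformation_retraction eta ->
  exists (C6 : nat -> nat -> nat -> K) (C7 : nat -> nat -> nat -> nat -> K),
  [/\ monotone3 C6, monotone4 C7 &
  forall C1 lambda1 : nat -> nat -> K,
  (forall delta s, 0 < C1 delta s) ->
  (forall delta s, 0 < lambda1 delta s < 1) ->
  exists2 C8 : nat -> nat -> nat -> K -> nat -> nat -> K,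
  monotone6 C8 &
  forall (delta : nat) (w : G -> seq G)
    (phi : nat -> G -> G -> chain rat (@bar G) 1),
  (0 < delta)%N -> (12 * delta <= r)%N ->
  hyperbolic (cayley_dist : cayley_point K S -> cayley_point K S -> K)
    delta%:R ->
  geodesic_words S w ->
  mineyev_maps S delta w (C1 delta #|` S|) (lambda1 delta #|` S|) phi ->
  exists h : G -> forall m, {linear chain rat (rips S r) m ->
                                    chain rat (rips S r) m.+1},
  [/\ (forall x (c : chain rat (rips S r) 0), boundary (h x 0%N c) = c) /\
      (forall x m (c : chain rat (rips S r) m.+1),
         h x m (boundary c) + boundary (h x m.+1 c) = c),
      (forall g x m (c : chain rat (rips S r) m),
         act g (h x m c) = h (g * x)%g m (act g c)),
      (forall x m (a : simplex (rips S r) m) (b : simplex (rips S r) m.+1),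
         (coef (h x m (mkmalgU a 1)) b != 0 ->
          vertices b `<=`
            nbhd_of (word_metric K S)
              (geod (word_metric K S) (vertices a `|` [set x]))
              (C6 delta r m)) /\
         `|ratr (coef (h x m (mkmalgU a 1)) b)| <= C7 delta #|` S| r m) &
      (forall x x' m (a : simplex (rips S r) m)
         (b : simplex (rips S r) m.+1),
         `|ratr (coef (h x m (mkmalgU a 1) - h x' m (mkmalgU a 1)) b)|
         <= C8 delta #|` S| r (lambda1 delta #|` S|) m (word_dist S x x')
            * (lambda1 delta #|` S|) `^ (gromov_min K x x' b))]].
Proof.
move=> symS genS _ edr.
have [p [p1 pD]] := rational_projection K[i].
have [M hM] : exists M : nat -> nat -> nat, forall m D x s, size s = m.+1 ->
    (forall y, y \in s -> (word_dist S x y <= D)%N) ->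
    bounded_by eta p m.+1 (M m D) s.
  have /choice[M hM] : forall q : nat * nat, exists M, forall x s, size s = q.1.+1 ->
      (forall y, y \in s -> (word_dist S x y <= q.2)%N) ->
      bounded_by eta p q.1.+1 M s.
    move=> [m D]; exact: (retract_bounded genS edr p1 pD m.+1 m.+1 D).
  by exists (fun m D => M (m, D)) => m D; apply: (hM (m, D)).
(* [G], [S], [r] and the retraction are fixed, so the constants may depend on
   them arbitrarily; only the dependence on the hyperbolicity constant, the
   degree and the distance of the base points has to be made monotone. *)
pose A d := (4 * (d + 3))%N; pose T d := (10 * d)%N.
pose M' d m e := M m (3 * A d + 3 * e + 2 * r + T d)%N.
pose win d m e : nat := (2 * (e + 2 * r + T d + M' d m e) + 2)%N.
pose c6 d m (_ : nat) : K := (M' d m 0 + A d)%:R.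
pose c7 d m (_ : nat) : K :=
  2 ^+ m * ((win d m 0)%:R * (m%:R * (M' d m 0)%:R)) + 1.
have c6_ge0 d m l : 0 <= c6 d m l by apply: ler0n.
have c7_ge0 d m l : 0 <= c7 d m l.
  by rewrite addr_ge0 // !mulr_ge0 // exprn_ge0.
exists (fun d _ m => majorant c6 d m 0), (fun d _ _ m => majorant c7 d m 0); split.
- by move=> d d' _ _ m m' dd _ mm; apply: majorant_mono.
- by move=> d d' dd _ _ _ _ m m' _ _ mm; apply: majorant_mono.
move=> C1 lambda1 C1_gt0 l01.
pose gap d m e : nat := (2 * A d + M' d m e + 2 * e + r + T d)%N.
pose c8 d m e : K := 2 ^+ m * ((win d m e)%:R * ((m * m.+1)%:R *
  ((2 * m)%:R * (C1 d #|` S| * lambda1 d #|` S| `^ (- (gap d m e)%:R))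
   * (M' d m e)%:R))) + 1.
have c8_ge0 d m e : 0 <= c8 d m e.
  rewrite addr_ge0 // !mulr_ge0 ?exprn_ge0 ?powR_ge0 //; exact/ltW/C1_gt0.
exists (fun d _ _ _ m e => majorant c8 d m e).
  by move=> d d' _ _ _ _ _ _ m m' e e' dd _ _ _ mm ee; apply: majorant_mono.
move=> d w phi d0 dr hyp wG mm.
pose fl := flow phi.
have T0 : (0 < T d)%N by rewrite /T; lia.
have stop x k y : (word_dist S x y <= k)%N -> fl x k y = cls bar [tuple x].
  by move=> h; apply: (flow_stop genS mm); apply: leq_trans h _; rewrite leq_pmull.
have track := flow_tracks symS genS hyp wG mm.
have fprob := flow_prob mm.
have fmass x k y : mass (fl x k y) = 1 by have [] := fprob x k y.
exists (fun x m => rips_contraction eta p fl x (m := m)).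
have coefh x m (a : simplex (rips S r) m) (b : simplex (rips S r) m.+1) :
    coef (rips_contraction eta p fl x (mkmalgU a 1)) b = coef (cone eta p fl x m (val a)) b.
  by rewrite /rips_contraction lin_extU.
split.
- split=> [x c|x m c]; first exact: (contraction0 edr p1 pD).
  exact: (contraction_homotopy edr p1 pD _ fmass stop).
- by move=> g x m c; apply: contraction_act => //; apply: (flow_act mm).
- move=> x m a b; rewrite coefh; case: m a b => [|m] a b.
    rewrite (tuple0 (val a)) coef_cone_nil //; split.
      move=> h; have bx : val b = [tuple x].
        by move: h; have [//|_] := eqVneq (val b) [tuple x]; rewrite eqxx.
      move=> v /=; rewrite /vertices /= bx inE => /eqP ->.
      apply: (@near_nbhd_of _ _ _ _ _ _ x); last first.
        rewrite /word_metric word_dist0; apply: le_trans (le_majorant _ _ _ c6_ge0).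
        exact: c6_ge0.
      by exists x, x; split; [right | right | rewrite /word_metric word_dist0 // addr0].
    apply: (@le_trans _ _ 1).
      by case: (val b == _); rewrite ?rmorph1 ?rmorph0 ?normr1 ?normr0.
    apply: le_trans (le_majorant _ _ _ c7_ge0).
    by rewrite lerDr !mulr_ge0 // exprn_ge0.
  have [Ra _] := simplexP a; have sa := size_tuple (val a).
  have hMd := hM m.+1 (3 * A d + 3 * 0 + 2 * r + T d)%N.
  have xx : (word_dist S x x <= 0)%N by rewrite word_dist0.
  split.
    move=> nz v vb.
    have [k [z [x0 [k0 [y [hx _ ya cz]]]] hz]] :=
      coef_cone_active symS genS pD T0 fprob (flow_stop genS mm) track hMd xx Ra sa
        (ltn0Sn m) nz.
    have {}hx : x0 = x by case: hx. subst x0.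
    have [u xu zu] := flow_near track cz.
    apply: (@near_nbhd_of _ _ _ _ _ _ u).
      exists x, y; split; [by right | by left |].
      by rewrite /word_metric -natrD xu.
    apply: le_trans (le_majorant _ _ _ c6_ge0); rewrite /word_metric ler_nat.
    apply: leq_trans (word_dist_tri genS z v u) _.
    by rewrite leq_add //; apply: hz.
  apply: le_trans (le_majorant _ _ _ c7_ge0).
  have := coef_cone_bound symS genS pD T0 fprob (flow_stop genS mm) track hMd b xx Ra sa
    (ltn0Sn m).
  rewrite -(ler_rat K) ratr_norm => h; apply: (le_trans h).
  by rewrite !rmorphM rmorphXn /= !ratr_nat lerDl.
move=> x x' m a b.
have -> : coef (rips_contraction eta p fl x (mkmalgU a 1)
                - rips_contraction eta p fl x' (mkmalgU a 1)) b
  = coef (cone eta p fl x m (val a)) b - coef (cone eta p fl x' m (val a)) b.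
  by rewrite /coef mcoeffB -!/(coef _ b) !coefh.
have lam := l01 d #|` S|; have /andP[lam0 lam1] := lam.
case: m a b => [|m] a b.
  rewrite (tuple0 (val a)); apply: le_trans (coef_cone_nil_close _ _ _ _ _ _ _ _ _ lam) _ => //.
  rewrite ler_peMl ?powR_ge0 //; apply: le_trans (le_majorant _ _ _ c8_ge0).
  rewrite lerDr !mulr_ge0 ?exprn_ge0 ?powR_ge0 //; exact/ltW/C1_gt0.
have [Ra _] := simplexP a; have sa := size_tuple (val a).
set e := word_dist S x x'.
have hMd := hM m.+1 (3 * A d + 3 * e + 2 * r + T d)%N.
pose gm := gromov_min K x x' b.
pose E := C1 d #|` S| * lambda1 d #|` S| `^ (- (gap d m.+1 e)%:R)
  * lambda1 d #|` S| `^ gm.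
have E0 : 0 <= E by rewrite !mulr_ge0 ?powR_ge0 //; exact/ltW/C1_gt0.
apply: le_trans (coef_cone_close symS genS pD T0 fprob (flow_stop genS mm) track
  hMd (leqnn e) Ra sa (ltn0Sn m) E0 _) _; last first.
  apply: le_trans (ler_wpM2r (powR_ge0 _ _) (le_majorant _ _ _ c8_ge0)).
  rewrite /c8 [leRHS]mulrDl mul1r; apply: ler_wpDr; first exact: powR_ge0.
  rewrite le_eqVlt; apply/orP; left; apply/eqP.
  rewrite -/(M' d m.+1 e) -/(win d m.+1 e) /E; move: (_ `^ gm) (_ `^ _) => u v.
  move: (win _ _ _)%:R (M' _ _ _)%:R (m.+1 * m.+2)%:R (2 * m.+1)%:R => W N0 B B'.
  ring.
move=> k j y rk jk ys.
apply: le_trans (flow_decay mm x x' j y (C1_gt0 _ _)) _.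
rewrite /E -mulrA ler_wpM2l ?(ltW (C1_gt0 _ _)) // -powRD; last first.
  by rewrite (gt_eqF lam0) implybT.
apply: ger_powR; first by rewrite lam0 ltW.
have hq : gm <= gromov (word_metric K S) x x' (thead (val b)) by exact: bigmin_le_id.
have h := relevant_gromov symS genS track (leqnn e) Ra rk jk ys.
move: h hq; cbv zeta; rewrite -(ler_nat K) /gromov /word_metric /gap /A /M' /T.
rewrite !(natrD, natrM); lra.
Qed.
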